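(* The composite $\langle M\rangle\backslash\mathcal{F}\longleftrightarrow M\longrightarrow f_M$, in which an oriented çark with a base edge is identified with the corresponding hyperbolic element $M$ of $\mathrm{PSL}_2(\mathbf{Z})$, defines a surjection from the set of oriented çarks with a base edge (up to isomorphism) onto the set of primitive indefinite integral binary quadratic forms of non-square discriminant.
   Context: Let $S(z)=-1/z$ and $R(z)=(z-1)/z$, elements of orders $2$ and $3$ which generate $\mathrm{PSL}_2(\mathbf{Z})=\langle S\rangle*\langle R\rangle$. The bipartite Farey tree $\mathcal{F}$ is the bipartite graph with edge set $\{\{W\}: W\in\mathrm{PSL}_2(\mathbf{Z})\}$, $\otimes$-vertices $\{W,WS\}$ and $\bullet$-vertices $\{W,WR,WR^2\}$ ($W\in\mathrm{PSL}_2(\mathbf{Z})$); the edge $\{W\}$ joins $\{W,WS\}$ to $\{W,WR,WR^2\}$, and the edges at a $\bullet$-vertex are cyclically ordered as $(\{W\},\{WR\},\{WR^2\})$. $\mathrm{PSL}_2(\mathbf{Z})$ acts on $\mathcal{F}$ by left multiplication. A çark is a quotient ribbon graph $\langle M\rangle\backslash\mathcal{F}$ with $M\in\mathrm{PSL}_2(\mathbf{Z})$ hyperbolic ($|\mathrm{tr}\,M|>2$). Its unique circuit, the image of the axis of $M$ in $\mathcal{F}$, is its spine; a çark is oriented (directed) if an orientation of the spine is chosen. Hyperbolic elements $M$ correspond bijectively to isomorphism classes of oriented çarks with a base edge, by sending $M$ to $\langle M\rangle\backslash\mathcal{F}$ with base edge $\langle M\rangle\cdot\{I\}$ and the spine oriented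 in the direction in which $M$ translates its axis. A form $f=(A,B,C)$ means $f(x,y)=Ax^2+Bxy+Cy^2$ with $A,B,C\in\mathbf{Z}$; its discriminant is $\Delta(f)=B^2-4AC$; it is primitive if $\gcd(A,B,C)=1$ and indefinite if $\Delta(f)>0$. For a hyperbolic element $M=\begin{pmatrix}p&q\\ r&s\end{pmatrix}\in\mathrm{PSL}_2(\mathbf{Z})$ put $$f_M=\frac{\mathrm{sgn}(p+s)}{\gcd(q,s-p,r)}\,(r,\ s-p,\ -q).$$ *)

(* Defs.v *)
From HB Require Import structures.
From mathcomp Require Import all_boot all_order all_algebra.
From mathcomp Require Import boolp classical_sets functions.
Set Implicit Arguments.
Unset Strict Implicit.
Unset Printing Implicit Defensive.
Import Order.TTheory GRing.Theory Num.Theory.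
Local Open Scope classical_set_scope.
Local Open Scope ring_scope.
Local Open Scope quotient_scope.

Record SL2Z := MkSL2Z { SL2Z_val : 'M[int]_2; _ : \det SL2Z_val == 1 }.
HB.instance Definition _ := [isSub for SL2Z_val].
HB.instance Definition _ := [Choice of SL2Z by <:].

Lemma SL2Z_unit (A : SL2Z) : val A \in unitmx.
Proof. by rewrite unitmxE (eqP (valP A)) unitr1. Qed.

Lemma SL2Z_mul_subproof (A B : SL2Z) : \det (val A *m val B) == 1.
Proof. by rewrite det_mulmx (eqP (valP A)) (eqP (valP B)) mulr1. Qed.
Definition SL2Z_mul (A B : SL2Z) : SL2Z := MkSL2Z (SL2Z_mul_subproof A B).

Lemma SL2Z_inv_subproof (A : SL2Z) : \det (invmx (val A)) == 1.
Proof. by rewrite det_inv (eqP (valP A)) invr1. Qed.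
Definition SL2Z_inv (A : SL2Z) : SL2Z := MkSL2Z (SL2Z_inv_subproof A).

Lemma SL2Z_one_subproof : \det (1%:M : 'M[int]_2) == 1.
Proof. by rewrite det1. Qed.
Definition SL2Z_one : SL2Z := MkSL2Z SL2Z_one_subproof.

Definition psl_eq (A B : SL2Z) : bool :=
  (val A == val B) || (val A == - val B).

Lemma psl_eq_refl : reflexive psl_eq.
Proof. by move=> A; rewrite /psl_eq eqxx. Qed.
Lemma psl_eq_sym : symmetric psl_eq.
Proof.
by move=> A B; rewrite /psl_eq eq_sym; congr (_ || _); rewrite eq_sym eqr_oppLR.
Qed.
Lemma psl_eq_trans : transitive psl_eq.
Proof.
move=> B A C; rewrite /psl_eq => /orP[] /eqP-> /orP[] /eqP->;
  by rewrite ?opprK !eqxx ?orbT.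
Qed.
Canonical psl_equiv := EquivRel psl_eq psl_eq_refl psl_eq_sym psl_eq_trans.

Definition PSL2Z := {eq_quot psl_eq}.
HB.instance Definition _ := Choice.on PSL2Z.
HB.instance Definition _ := EqQuotient.on PSL2Z.

Definition psl_mul : PSL2Z -> PSL2Z -> PSL2Z := lift_op2 PSL2Z SL2Z_mul.
Definition psl_inv : PSL2Z -> PSL2Z := lift_op1 PSL2Z SL2Z_inv.
Definition psl_one : PSL2Z := \pi SL2Z_one.

Lemma psl_eqP (A B : SL2Z) :
  reflect (val A = val B \/ val A = - val B) (A == B %[mod PSL2Z]).
Proof.
rewrite eqmodE /= /psl_eq.
by apply: (iffP orP) => -[/eqP|/eqP]; [left|right|left|right].
Qed.

Lemma psl_mulE : {morph \pi_PSL2Z : A B / SL2Z_mul A B >-> psl_mul A B}.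
Proof.
move=> A B; unlock psl_mul; apply/eqP/psl_eqP => /=.
have /psl_eqP [->|->] : A == repr (\pi_PSL2Z A) %[mod PSL2Z] by rewrite reprK.
all: have /psl_eqP [->|->] : B == repr (\pi_PSL2Z B) %[mod PSL2Z]
  by rewrite reprK.
all: rewrite ?mulNmx ?mulmxN ?opprK; by [left|right].
Qed.

Lemma invmxN (A : 'M[int]_2) : A \in unitmx -> invmx (- A) = - invmx A.
Proof.
move=> uA; rewrite -(scaleN1r A) invmxZ ?unitmxZ ?unitrN1 //.
by rewrite invrN1 scaleN1r.
Qed.

Lemma psl_invE : {morph \pi_PSL2Z : A / SL2Z_inv A >-> psl_inv A}.
Proof.
move=> A; unlock psl_inv; apply/eqP/psl_eqP => /=.
have /psl_eqP [->|->] : A == repr (\pi_PSL2Z A) %[mod PSL2Z] by rewrite reprK.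
  by left.
by right; rewrite invmxN // SL2Z_unit.
Qed.

Lemma psl_mulA : associative psl_mul.
Proof.
move=> x y z; rewrite -[x]reprK -[y]reprK -[z]reprK -!psl_mulE.
by congr \pi; apply: val_inj; rewrite /= mulmxA.
Qed.
Lemma psl_mul1 : left_id psl_one psl_mul.
Proof.
move=> x; rewrite -[x]reprK /psl_one -?psl_mulE.
by congr \pi; apply: val_inj; rewrite /= mul1mx.
Qed.
Lemma psl_mulr1 : right_id psl_one psl_mul.
Proof.
move=> x; rewrite -[x]reprK /psl_one -?psl_mulE.
by congr \pi; apply: val_inj; rewrite /= mulmx1.
Qed.
Lemma psl_mulV : left_inverse psl_one psl_inv psl_mul.
Proof.
move=> x; rewrite -[x]reprK /psl_one -psl_invE -!psl_mulE.
by congr \pi; apply: val_inj; rewrite /= mulVmx // SL2Z_unit.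
Qed.
Lemma psl_mulrV : right_inverse psl_one psl_inv psl_mul.
Proof.
move=> x; rewrite -[x]reprK /psl_one -psl_invE -!psl_mulE.
by congr \pi; apply: val_inj; rewrite /= mulmxV // SL2Z_unit.
Qed.
HB.instance Definition _ :=
  isGroup.Build PSL2Z psl_mulA psl_mul1 psl_mulr1 psl_mulV psl_mulrV.

Lemma psl_piM (A B : SL2Z) :
  (\pi_PSL2Z A * \pi_PSL2Z B)%g = \pi_PSL2Z (SL2Z_mul A B).
Proof. exact: esym (psl_mulE A B). Qed.

Definition mx2 (p q r s : int) : 'M[int]_2 :=
  \matrix_(i, j) nth 0 (nth [::] [:: [:: p; q]; [:: r; s]] i) j.

Lemma det_mx2 p q r s : \det (mx2 p q r s) = p * s - q * r.
Proof. rewrite (expand_det_row _ 0) !big_ord_recl big_ord0 /cofactor !det_mx11 !mxE /=.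
by rewrite expr0 expr1 mul1r addr0 mulN1r mulrN. Qed.

Lemma genS_subproof : \det (mx2 0 (-1) 1 0) == 1.
Proof. by rewrite det_mx2. Qed.
Lemma genR_subproof : \det (mx2 1 (-1) 1 0) == 1.
Proof. by rewrite det_mx2. Qed.

(* The Moebius transformations S(z) = -1/z and R(z) = (z-1)/z. *)
Definition genS : PSL2Z := \pi_PSL2Z (MkSL2Z genS_subproof).
Definition genR : PSL2Z := \pi_PSL2Z (MkSL2Z genR_subproof).

Lemma genR3 : (genR * (genR * genR) = 1)%g.
Proof.
rewrite /genR !psl_piM.
apply/eqP/psl_eqP; right; apply/matrixP => i j.
rewrite !mxE !big_ord_recl !big_ord0 !mxE !big_ord_recl !big_ord0 !mxE /=.
by case: i => [[|[|[]]]] //; case: j => [[|[|[]]]].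
Qed.

(* The trace of an element of PSL2Z is defined up to sign only: [abs_tr] and,
   below, [bqf_of] do not depend on the representative. *)
Definition abs_tr (M : PSL2Z) : int := `|\tr (val (repr M))|.
Definition hyperbolic : set PSL2Z := [set M | 2 < abs_tr M].

Lemma abs_tr_pi (A : SL2Z) : abs_tr (\pi_PSL2Z A) = `|\tr (val A)|.
Proof.
rewrite /abs_tr.
have /psl_eqP [->//|->] : A == repr (\pi_PSL2Z A) %[mod PSL2Z] by rewrite reprK.
by rewrite (raddfN (@mxtrace int 2)) normrN.
Qed.

(* The form A x^2 + B x y + C y^2. *)
Record bqf := BQF { qA : int; qB : int; qC : int }.

Definition disc (f : bqf) : int := qB f ^+ 2 - 4 * qA f * qC f.
Definition primitive (f : bqf) : Prop := gcdz (gcdz (qA f) (qB f)) (qC f) = 1.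
Definition indefinite (f : bqf) : Prop := 0 < disc f.
Definition square_disc (f : bqf) : Prop := exists k : int, disc f = k ^+ 2.

(* The divisions are exact. *)
Definition bqf_mx (X : 'M[int]_2) : bqf :=
  let p := X 0 0 in let q := X 0 1 in let r := X 1 0 in let s := X 1 1 in
  let g := gcdz q (gcdz (s - p) r) in
  BQF (sgz (p + s) * (r %/ g)%Z) (sgz (p + s) * ((s - p) %/ g)%Z)
      (sgz (p + s) * (- q %/ g)%Z).

Definition bqf_of (M : PSL2Z) : bqf := bqf_mx (val (repr M)).

Lemma divzNl (m d : int) : (d %| m)%Z -> (- m %/ d)%Z = - (m %/ d)%Z.
Proof.
have [->|d0] := eqVneq d 0; first by rewrite !divz0 oppr0.
by move=> /dvdzP[k ->]; rewrite -mulNr !mulzK.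
Qed.

Lemma bqf_mxN (X : 'M[int]_2) : bqf_mx (- X) = bqf_mx X.
Proof.
rewrite /bqf_mx !mxE; set p := X 0 0; set q := X 0 1; set r := X 1 0.
set s := X 1 1.
have -> : - p - s = - (p + s) by rewrite opprD.
have -> : - s - - p = - (s - p) by rewrite opprD.
rewrite sgzN !gcdNz !gcdzN; set g := gcdz _ _.
have gq : (g %| q)%Z by rewrite dvdz_gcdl.
have gsp : (g %| s - p)%Z by rewrite (dvdz_trans (dvdz_gcdr _ _)) ?dvdz_gcdl.
have gr : (g %| r)%Z by rewrite (dvdz_trans (dvdz_gcdr _ _)) ?dvdz_gcdr.
by rewrite !divzNl ?rpredN // !mulrNN.
Qed.

Lemma bqf_of_pi (A : SL2Z) : bqf_of (\pi_PSL2Z A) = bqf_mx (val A).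
Proof.
rewrite /bqf_of.
have /psl_eqP [->//|->] : A == repr (\pi_PSL2Z A) %[mod PSL2Z] by rewrite reprK.
by rewrite bqf_mxN.
Qed.

(* Bipartite ribbon graphs: [wend] and [bend] give the ⊗- and the •-end
   of an edge, and [next] is the cyclic successor around its •-end.  The
   ⊗-vertices carry no order, since they have at most two edges here. *)
Record ribbonGraph := RibbonGraph {
  edge : Type;
  wvtx : Type;
  bvtx : Type;
  wend : edge -> wvtx;
  bend : edge -> bvtx;
  next : edge -> edge;
  nextP : forall e e', bend e = bend e' <-> exists n : nat, e' = iter n next e }.

Definition to_range (T U : Type) (f : T -> U) (x : T) : range f :=
  SigSub (mem_set (imageT f x)).

Definition farey_w (W : PSL2Z) : set PSL2Z := [set W; (W * genS)%g].
Definition farey_b (W : PSL2Z) : set PSL2Z :=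
  [set W; (W * genR)%g; (W * (genR * genR))%g].

Lemma farey_b_next (W : PSL2Z) : farey_b (W * genR)%g = farey_b W.
Proof.
rewrite /farey_b -!mulgA genR3 mulg1.
by apply/seteqP; split=> x /= [[->|->]|->]; [left; right|right|left; left
  |right|left; left|left; right].
Qed.

Lemma farey_b_eq (W W' : PSL2Z) :
  farey_b W = farey_b W' <->
  exists n : nat, W' = iter n (fun V => (V * genR)%g) W.
Proof.
split=> [eWW'|[n ->]].
  have : farey_b W W' by rewrite eWW'; left; left.
  by case=> [[->|->]|->]; [exists 0%N|exists 1%N|exists 2%N; rewrite /= mulgA].
by elim: n => //= n IHn; rewrite farey_b_next.
Qed.

Lemma farey_nextP (W W' : PSL2Z) :
  to_range farey_b W = to_range farey_b W' <->
  exists n : nat, W' = iter n (fun V => (V * genR)%g) W.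
Proof.
rewrite -farey_b_eq; split=> [/(congr1 val)//|eWW'].
exact: val_inj.
Qed.

Definition farey : ribbonGraph :=
  @RibbonGraph PSL2Z (range farey_w) (range farey_b)
    (to_range farey_w) (to_range farey_b) (fun W => (W * genR)%g) farey_nextP.

Definition cyc (M : PSL2Z) : set PSL2Z :=
  [set W | exists n : nat, W = (M ^+ n)%g \/ W = (M ^- n)%g].

Lemma cyc1 M : cyc M 1%g.
Proof. by exists 0%N; left. Qed.

Lemma cycV M W : cyc M W -> cyc M (W^-1)%g.
Proof. by move=> [n [->|->]]; exists n; rewrite ?invgK; [right|left]. Qed.

Lemma cycM M W W' : cyc M W -> cyc M W' -> cyc M (W * W')%g.
Proof.
have pm m n : cyc M (M ^+ m * M ^- n)%g.
  have [le_nm|/ltnW le_mn] := leqP n m.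
    by exists (m - n)%N; left; rewrite expgnFr.
  by exists (n - m)%N; right; rewrite expgnFr // invgF.
have mp m n : cyc M (M ^- m * M ^+ n)%g.
  have -> : (M ^- m * M ^+ n = M ^+ n * M ^- m)%g; last exact: pm.
  by apply: commute_sym; apply: commuteV; apply: commuteX2.
move=> [m [->|->]] [n [->|->]] //.
  by exists (m + n)%N; left; rewrite expgnDr.
by exists (n + m)%N; right; rewrite expgnDr invgM.
Qed.

(* The action of PSL2Z on the vertices of [farey], which are sets of edges. *)
Definition lact (h : PSL2Z) (v : set PSL2Z) : set PSL2Z :=
  [set (h * W)%g | W in v].

Definition edge_orbit (M W : PSL2Z) : set PSL2Z :=
  [set (h * W)%g | h in cyc M].
Definition vtx_orbit (M : PSL2Z) (v : set PSL2Z) : set (set PSL2Z) :=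
  [set lact h v | h in cyc M].

Definition cark_edge (M : PSL2Z) : Type := range (edge_orbit M).
Definition cark_wvtx (M : PSL2Z) : Type :=
  [set vtx_orbit M v | v in range farey_w].
Definition cark_bvtx (M : PSL2Z) : Type :=
  [set vtx_orbit M v | v in range farey_b].

Definition cark_proj (M W : PSL2Z) : cark_edge M := to_range (edge_orbit M) W.

Lemma cark_edgeP M (e : cark_edge M) : exists W, e = cark_proj M W.
Proof. by have /set_mem[W _ eW] := valP e; exists W; apply: val_inj. Qed.

Lemma edge_orbitE M (f : PSL2Z -> set PSL2Z) W :
  (forall h V, f (h * V)%g = lact h (f V)) ->
  f @` edge_orbit M W = vtx_orbit M (f W).
Proof. by move=> fE; rewrite /edge_orbit image_comp; apply: eq_imagel => h _ /=. Qed.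

Lemma farey_w_lact h W : farey_w (h * W)%g = lact h (farey_w W).
Proof. by rewrite /lact image_setU !image_set1 /farey_w mulgA. Qed.

Lemma farey_b_lact h W : farey_b (h * W)%g = lact h (farey_b W).
Proof. by rewrite /lact !image_setU !image_set1 /farey_b !mulgA. Qed.

(* The end of an orbit of edges is the set of the ends of these edges. *)
Lemma cark_wend_subproof M (e : cark_edge M) :
  [set vtx_orbit M v | v in range farey_w] (farey_w @` val e).
Proof.
have [W ->] := cark_edgeP e.
by exists (farey_w W); rewrite ?edge_orbitE//; exact: farey_w_lact.
Qed.
Definition cark_wend M (e : cark_edge M) : cark_wvtx M :=
  SigSub (mem_set (cark_wend_subproof e)).

Lemma cark_bend_subproof M (e : cark_edge M) :
  [set vtx_orbit M v | v in range farey_b] (farey_b @` val e).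
Proof.
have [W ->] := cark_edgeP e.
by exists (farey_b W); rewrite ?edge_orbitE//; exact: farey_b_lact.
Qed.
Definition cark_bend M (e : cark_edge M) : cark_bvtx M :=
  SigSub (mem_set (cark_bend_subproof e)).

Lemma edge_orbitR M W V :
  [set (U * V)%g | U in edge_orbit M W] = edge_orbit M (W * V)%g.
Proof. by rewrite /edge_orbit image_comp; apply: eq_imagel => h _ /=; rewrite mulgA. Qed.

Lemma cark_next_subproof M (e : cark_edge M) :
  range (edge_orbit M) [set (W * genR)%g | W in val e].
Proof.
by have [W ->] := cark_edgeP e; exists (W * genR)%g; rewrite ?edge_orbitR.
Qed.
Definition cark_next M (e : cark_edge M) : cark_edge M :=
  SigSub (mem_set (cark_next_subproof e)).

Lemma cark_next_proj M W : cark_next (cark_proj M W) = cark_proj M (W * genR)%g.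
Proof. by apply: val_inj => /=; rewrite edge_orbitR. Qed.

Lemma cark_iter_next M W n : iter n (@cark_next M) (cark_proj M W) =
  cark_proj M (iter n (fun V => (V * genR)%g) W).
Proof. by elim: n => //= n ->; rewrite cark_next_proj. Qed.

Lemma cark_proj_eq M h W : cyc M h -> cark_proj M (h * W)%g = cark_proj M W.
Proof.
move=> Mh; apply: val_inj; apply/seteqP; split=> _ [k Mk <-] /=.
  by exists (k * h)%g; rewrite ?mulgA//; apply: cycM.
exists (k * h^-1)%g; first by apply: cycM => //; apply: cycV.
by rewrite mulgA mulgVK.
Qed.

Lemma cark_nextP M (e e' : cark_edge M) :
  cark_bend e = cark_bend e' <-> exists n : nat, e' = iter n (@cark_next M) e.
Proof.
have [[W ->] [W' ->]] := (cark_edgeP e, cark_edgeP e'); split.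
  move=> /(congr1 val) /= eWW'.
  have : (farey_b @` edge_orbit M W') (farey_b W').
    by exists W' => //; exists 1%g; rewrite ?mul1g//; apply: cyc1.
  rewrite -eWW' => -[_ [h Mh <-] /farey_b_eq [n ->]]; exists n.
  by rewrite -cark_iter_next cark_proj_eq.
move=> [n]; rewrite cark_iter_next => ->.
elim: n => //= n ->; rewrite -cark_next_proj; apply: val_inj => /=.
by rewrite image_comp; apply: eq_imagel => U _ /=; rewrite farey_b_next.
Qed.

(* The quotient <M>\F. *)
Definition cark_graph (M : PSL2Z) : ribbonGraph :=
  RibbonGraph (@cark_wend M) (@cark_nextP M).

(* Bi-infinite paths in a tree, as sequences of edges: no edge is repeated,
   and [g (2 n)] is traversed from its ⊗-end to its •-end. *)
Definition is_line (G : ribbonGraph) (g : int -> edge G) : Prop :=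
  injective g /\ forall n : int,
    bend (g (2 * n)) = bend (g (2 * n + 1)) /\
    wend (g (2 * n + 1)) = wend (g (2 * n + 2)).

Definition translates (M : PSL2Z) (g : int -> edge farey) : Prop :=
  is_line g /\
  exists2 l : int, 0 < l & forall n : int, (M * g n)%g = g (n + l).

Definition axis (M : PSL2Z) : set (edge farey) :=
  [set W | exists2 g, translates M g & exists n : int, W = g n].

(* The edges of the axis which M traverses from the ⊗- to the •-end. *)
Definition axis_pos (M : PSL2Z) : set (edge farey) :=
  [set W | exists2 g, translates M g & exists n : int, W = g (2 * n)].

Definition spine (M : PSL2Z) : set (edge (cark_graph M)) :=
  cark_proj M @` axis M.
Arguments spine M : clear implicits.

(* An orientation of a circuit C is encoded by the set O of the edges of C
   directed from their ⊗-end to their •-end; at each vertex of C, one of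
   the two edges of C is directed towards it and the other one away from it. *)
Definition is_orientation (G : ribbonGraph) (C O : set (edge G)) : Prop :=
  O `<=` C /\
  forall e e', C e -> C e' -> e <> e' ->
    bend e = bend e' \/ wend e = wend e' -> (O e <-> ~ O e').

Record based_cark := BasedCark {
  cark_mat : PSL2Z;
  cark_dir : set (edge (cark_graph cark_mat));
  cark_base : edge (cark_graph cark_mat) }.
Arguments cark_dir : clear implicits.
Arguments cark_base : clear implicits.

Definition oriented_cark : set based_cark :=
  [set X | hyperbolic (cark_mat X) /\
           is_orientation (spine (cark_mat X)) (cark_dir X)].

Record is_iso (G G' : ribbonGraph) (fE : edge G -> edge G')
    (fw : wvtx G -> wvtx G') (fb : bvtx G -> bvtx G') : Prop := IsIso {
  iso_edge : bijective fE;
  iso_wvtx : bijective fw;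
  iso_bvtx : bijective fb;
  iso_wend : forall e, wend (fE e) = fw (wend e);
  iso_bend : forall e, bend (fE e) = fb (bend e);
  iso_next : forall e, next (fE e) = fE (next e) }.

(* The spine need not be mentioned: being the unique circuit, it is carried to
   the spine by every isomorphism of graphs. *)
Definition cark_iso (X Y : based_cark) : Prop :=
  exists fE fw fb,
    [/\ @is_iso (cark_graph (cark_mat X)) (cark_graph (cark_mat Y)) fE fw fb,
        fE @` cark_dir X = cark_dir Y & fE (cark_base X) = cark_base Y].

Definition cark_class (X : based_cark) : set based_cark :=
  [set Y | oriented_cark Y /\ cark_iso X Y].

Definition cark_classes : set (set based_cark) := cark_class @` oriented_cark.

(* <M>\F with base edge <M>{I}, its spine being oriented in the direction in
   which M translates its axis. *)
Definition cark_of (M : PSL2Z) : based_cark :=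
  @BasedCark M (cark_proj M @` axis_pos M) (cark_proj M 1%g).

(* Main.v *)
Require Import Defs.
From mathcomp Require Import all_boot all_order all_algebra.
From mathcomp Require Import boolp classical_sets functions.
From mathcomp Require Import zify ring.
Local Open Scope classical_set_scope.

(* A line of the Farey tree is a bi-infinite sequence of steps W -> W U and
   W -> W L, with U = R S and L = R^-1 S the elementary unipotent matrices.  So
   W is an edge of the axis of a hyperbolic M, traversed by M from its ⊗-end to
   its •-end, iff W^-1 M W is a word in U and L, i.e. has positive entries (up
   to a common sign); for the opposite direction replace M by M^-1.  A step by
   R, R^-1 or S along the axis exchanges the two cases, whence the orientation.
   The existence of such W is Gauss' reduction of the form of M.  An isomorphism
   of based çarks commutes with right multiplication by R and S, hence sends
   <M>W to <M'>W and forces M' = M or M' = M^-1, the latter being excluded by the orientation.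
   Conversely an orientation is determined by its value at one edge of the
   spine, as any two edges of the axis traversed in the same direction differ by
   a word in U and L all of whose prefixes are on the axis.  Finally, the
   reduction cycle of a form of non-square discriminant yields a non-trivial
   automorph, and its entries are those of a multiple of the form. *)

Set Implicit Arguments.
Unset Strict Implicit.
Unset Printing Implicit Defensive.
Import Order.TTheory GRing.Theory Num.Theory.
Local Open Scope quotient_scope.
Local Open Scope ring_scope.

(** * The group PSL2(Z) *)

(* Junk value: the identity when [p * s - q * r <> 1]. *)
Definition psl (p q r s : int) : PSL2Z :=
  \pi_PSL2Z (insubd SL2Z_one (mx2 p q r s)).

Lemma val_sl p q r s : p * s - q * r = 1 ->
  val (insubd SL2Z_one (mx2 p q r s)) = mx2 p q r s.
Proof. by move=> d; rewrite insubdK // unfold_in det_mx2 d. Qed.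

Lemma mx2E (X : 'M[int]_2) : X = mx2 (X 0 0) (X 0 1) (X 1 0) (X 1 1).
Proof.
apply/matrixP => i j; rewrite mxE.
by case: i => [[|[|//]] hi]; case: j => [[|[|//]] hj] /=;
  congr (X _ _); apply: val_inj.
Qed.

Lemma mul_mx2 p q r s p' q' r' s' :
  mx2 p q r s *m mx2 p' q' r' s' =
  mx2 (p * p' + q * r') (p * q' + q * s') (r * p' + s * r') (r * q' + s * s').
Proof.
apply/matrixP => i j; rewrite !mxE !big_ord_recl big_ord0 !mxE /=.
by case: i => [[|[|//]] hi]; case: j => [[|[|//]] hj] /=; rewrite addr0.
Qed.

Lemma mx2_inj p q r s p' q' r' s' : mx2 p q r s = mx2 p' q' r' s' ->
  [/\ p = p', q = q', r = r' & s = s'].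
Proof.
move=> /matrixP e.
by split; [have := e 0 0|have := e 0 1|have := e 1 0|have := e 1 1];
  rewrite !mxE.
Qed.

Lemma oppmx2 p q r s : - mx2 p q r s = mx2 (- p) (- q) (- r) (- s).
Proof. by rewrite [LHS]mx2E !mxE. Qed.

Lemma tr_mx2 p q r s : \tr (mx2 p q r s) = p + s.
Proof. by rewrite /mxtrace !big_ord_recl big_ord0 !mxE /= addr0. Qed.

Lemma pslP (M : PSL2Z) : exists p q r s, p * s - q * r = 1 /\ M = psl p q r s.
Proof.
set X := val (repr M).
have dX : X 0 0 * X 1 1 - X 0 1 * X 1 0 = 1.
  by rewrite -det_mx2 -mx2E (eqP (valP (repr M))).
exists (X 0 0), (X 0 1), (X 1 0), (X 1 1); split=> //.
rewrite /psl -[LHS]reprK; congr \pi; apply: val_inj.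
by rewrite val_sl // -mx2E.
Qed.

Lemma psl_eqE p q r s p' q' r' s' :
  p * s - q * r = 1 -> p' * s' - q' * r' = 1 ->
  psl p q r s = psl p' q' r' s' ->
  [/\ p = p', q = q', r = r' & s = s'] \/
  [/\ p = - p', q = - q', r = - r' & s = - s'].
Proof.
move=> d d' /eqP /psl_eqP; rewrite !val_sl //.
by rewrite oppmx2; case=> /mx2_inj; [left|right].
Qed.

Lemma pslN p q r s : p * s - q * r = 1 ->
  psl (- p) (- q) (- r) (- s) = psl p q r s.
Proof.
move=> d; apply/eqP/psl_eqP; rewrite !val_sl -?oppmx2 ?mulrNN //.
by right.
Qed.

Lemma det_mul (p q r s p' q' r' s' : int) :
  p * s - q * r = 1 -> p' * s' - q' * r' = 1 ->
  (p * p' + q * r') * (r * q' + s * s') -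
  (p * q' + q * s') * (r * p' + s * r') = 1.
Proof. by move=> d d'; rewrite -(mul1r 1) -{1}d -d'; ring. Qed.

Lemma pslM p q r s p' q' r' s' :
  p * s - q * r = 1 -> p' * s' - q' * r' = 1 ->
  (psl p q r s * psl p' q' r' s')%g =
  psl (p * p' + q * r') (p * q' + q * s') (r * p' + s * r') (r * q' + s * s').
Proof.
move=> d d'; rewrite /psl psl_piM; congr \pi; apply: val_inj => /=.
by rewrite !val_sl ?mul_mx2 ?det_mul.
Qed.

Lemma psl1 : psl 1 0 0 1 = 1%g.
Proof.
rewrite /psl; change 1%g with psl_one; rewrite /psl_one; congr \pi.
by apply: val_inj; rewrite val_sl //= [RHS]mx2E !mxE.
Qed.

Lemma pslV p q r s : p * s - q * r = 1 ->
  (psl p q r s)^-1%g = psl s (- q) (- r) p.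
Proof.
move=> d; have d' : s * p - - q * - r = 1 by rewrite -d; ring.
have : (psl p q r s * psl s (- q) (- r) p = 1)%g.
  rewrite pslM // -psl1; congr psl; by rewrite -?d; ring.
by move/mulg1_eq.
Qed.

Lemma genSE : genS = psl 0 (-1) 1 0.
Proof. by rewrite /genS /psl; congr \pi; apply: val_inj; rewrite val_sl. Qed.
Lemma genRE : genR = psl 1 (-1) 1 0.
Proof. by rewrite /genR /psl; congr \pi; apply: val_inj; rewrite val_sl. Qed.

Definition genU : PSL2Z := psl 1 1 0 1.
Definition genL : PSL2Z := psl 1 0 1 1.

Lemma genUE : genU = (genR * genS)%g.
Proof. by rewrite genRE genSE pslM // /genU -pslN //. Qed.
Lemma genLE : genL = (genR^-1 * genS)%g.
Proof. by rewrite genRE genSE pslV // pslM // /genL -pslN //. Qed.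
Lemma genSS : (genS * genS = 1)%g.
Proof. by rewrite genSE pslM // -psl1 -pslN. Qed.
Lemma genRV : (genR^-1 = genR * genR)%g.
Proof. exact/mulg1_eq/genR3. Qed.

Lemma abs_tr_psl p q r s : p * s - q * r = 1 -> abs_tr (psl p q r s) = `|p + s|.
Proof. by move=> d; rewrite abs_tr_pi val_sl // tr_mx2. Qed.

Lemma bqf_of_psl p q r s : p * s - q * r = 1 ->
  let g := gcdz q (gcdz (s - p) r) in
  bqf_of (psl p q r s) = BQF (sgz (p + s) * (r %/ g)%Z)
    (sgz (p + s) * ((s - p) %/ g)%Z) (sgz (p + s) * (- q %/ g)%Z).
Proof. by move=> d; rewrite bqf_of_pi val_sl // /bqf_mx !mxE. Qed.

Lemma pslJ p q r s a b c d : p * s - q * r = 1 -> a * d - b * c = 1 ->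
  (psl p q r s ^ psl a b c d)%g =
  psl (d * (p * a + q * c) - b * (r * a + s * c))
      (d * (p * b + q * d) - b * (r * b + s * d))
      (a * (r * a + s * c) - c * (p * a + q * c))
      (a * (r * b + s * d) - c * (p * b + q * d)).
Proof.
move=> e1 e2; have e3 : d * a - - b * - c = 1 by rewrite -e2; ring.
by rewrite conjgE pslV // !pslM ?det_mul //; congr psl; ring.
Qed.

(** Normalising the trace to be positive makes the sign factor of the form equal to 1. *)
Lemma hyperbolicP M : hyperbolic M ->
  exists p q r s, [/\ p * s - q * r = 1, 2 < p + s & M = psl p q r s].
Proof.
have [p [q [r [s [d ->]]]]] := pslP M.
rewrite /hyperbolic /= abs_tr_psl // => h.
have [h0|h0] := lerP 0 (p + s).
  by exists p, q, r, s; split=> //; rewrite ger0_norm in h.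
exists (- p), (- q), (- r), (- s); split; last by rewrite pslN.
  by rewrite !mulrNN.
by lia.
Qed.

Lemma hyperbolicJ M W : hyperbolic M -> hyperbolic (M ^ W)%g.
Proof.
have [p [q [r [s [e ->]]]]] := pslP M.
have [a [b [c [d [e' ->]]]]] := pslP W.
have e3 : d * a - - b * - c = 1 by rewrite -e'; ring.
rewrite /hyperbolic /= pslJ // !abs_tr_psl //; last first.
  by rewrite -[RHS](det_mul e3 (det_mul e e')); ring.
suff -> : p + s = d * (p * a + q * c) - b * (r * a + s * c) +
  (a * (r * b + s * d) - c * (p * b + q * d)) by [].
rewrite -[LHS]mulr1 -e'; ring.
Qed.

Lemma hyperbolicV M : hyperbolic M -> hyperbolic M^-1%g.
Proof.
have [p [q [r [s [e ->]]]]] := pslP M.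
rewrite /hyperbolic /= pslV // !abs_tr_psl //; first by rewrite addrC.
by rewrite -e; ring.
Qed.

(** * Words in U and L *)

(** Euclid's algorithm on the lower row: right multiplication by powers of U = RS performs the
    divisions and S the exchanges. *)
Lemma psl_ind (P : PSL2Z -> Prop) :
  P 1%g -> (forall W, P (W * genR)%g <-> P W) ->
  (forall W, P (W * genS)%g <-> P W) ->
  forall W, P W.
Proof.
move=> P1 PR PS.
have PU W : P (W * genU)%g <-> P W by rewrite genUE mulgA PS PR.
have PUn (k : int) W : P (W * psl 1 k 0 1)%g <-> P W.
  have H n : P (W * psl 1 n%:Z 0 1)%g <-> P W.
    elim: n => [|n IH]; first by rewrite psl1 mulg1.
    rewrite -IH -[X in _ <-> X]PU -mulgA.
    by rewrite /genU pslM; [|lia..];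
      suff -> : psl 1 n.+1 0 1 = psl (1 * 1 + n%:Z * 0) (1 * 1 + n%:Z * 1)
        (0 * 1 + 1 * 0) (0 * 1 + 1 * 1); last by congr psl; lia.
  case: k => m0; first exact: H.
  have <- : (psl 1 m0.+1%:Z 0 1)^-1%g = psl 1 (Negz m0) 0 1.
    by rewrite pslV; [|lia].
  elim: m0.+1 => [|m IH]; first by rewrite psl1 invg1 mulg1.
  rewrite -PU -IH -mulgA.
  suff -> : ((psl 1 m.+1 0 1)^-1 * genU)%g = (psl 1 m 0 1)^-1%g by [].
  by rewrite !pslV ?pslM; [congr psl; lia|lia..].
suff H n (a b c d : int) :
    (absz c < n)%N -> a * d - b * c = 1 -> P (psl a b c d).
  by move=> W; have [a [b [c [d [e ->]]]]] := pslP W; apply: (H (absz c).+1).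
elim: n a b c d => // n IH a b c d cn e.
have [c0|c0] := eqVneq c 0.
  rewrite c0 mulr0 subr0 in e *.
  (* With c = 0 the matrix is, up to sign, a power of U. *)
  have -> : psl a b 0 d = psl 1 (a * b) 0 1.
    have [[-> ->]|[-> ->]] : (a = 1 /\ d = 1) \/ (a = -1 /\ d = -1).
    - have : a = 1 \/ a = -1 \/ a = 0 \/ 1 < a \/ a < -1 by lia.
      have : d <= -1 \/ d = 0 \/ 1 <= d by lia.
      by move=> [hd|[hd|hd]] [ha|[ha|[ha|[ha|ha]]]];
        (try by subst a; lia); (try by subst d; lia); nia.
    - by rewrite mul1r.
    - by rewrite -pslN; [congr psl; lia|lia].
  by rewrite -[psl _ _ _ _]mul1g PUn.
(* With d = kc + m the matrix is, up to sign, one with lower left entry m < |c| times S U^k. *)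
have h := divz_eq d c; have h2 := modz_ge0 d c0; have h3 := ltz_mod d c0.
move: (d %/ c)%Z (d %% c)%Z h h2 h3 => k m dE m0 mc.
have e1 : (b - a * k) * - c - - a * m = 1 by rewrite -e dE; ring.
have -> : psl a b c d = (psl (b - a * k) (- a) m (- c) * genS * psl 1 k 0 1)%g.
  rewrite -pslN // genSE !pslM //; first [by congr psl; lia | lia].
by rewrite PUn PS; apply: IH => //; lia.
Qed.

Definition letter (x : bool) : PSL2Z := if x then genU else genL.
Definition ul (w : seq bool) : PSL2Z :=
  foldr (fun x W => letter x * W)%g 1%g w.

Lemma ul_cat w w' : ul (w ++ w') = (ul w * ul w')%g.
Proof. by elim: w => [|x w IH] /=; rewrite ?mul1g // IH mulgA. Qed.

(** Each letter adds one row to the other, and determinant 1 forbids zero rows; so the sum of the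
    entries, 2 for the identity, grows with every letter. The bound keeps nonempty words away from
    the identity. *)
Lemma ul_nonneg w : exists a b c d,
  [/\ [/\ 0 <= a, 0 <= b, 0 <= c & 0 <= d], a * d - b * c = 1,
      (size w)%:Z + 2 <= a + b + c + d & ul w = psl a b c d].
Proof.
elim: w => [|x w [a [b [c [d [[a0 b0 c0 d0] e le_size wE]]]]]] /=.
  by exists 1, 0, 0, 1; split=> //; rewrite psl1.
have h : 0 < a /\ 0 < d by nia.
rewrite wE; case: x => /=; rewrite pslM //.
  exists (a + c), (b + d), c, d; split; [by split; lia|lia|lia|].
  by congr psl; ring.
exists a, b, (a + c), (b + d); split; [by split; lia|lia|lia|].
by congr psl; ring.
Qed.

(** Descent on the sum of the entries: unless the matrix is the identity, one row dominates the
    other, and subtracting the smaller row strips off the first letter. *)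
Lemma nonneg_ul a b c d : 0 <= a -> 0 <= b -> 0 <= c -> 0 <= d ->
  a * d - b * c = 1 -> exists w, psl a b c d = ul w.
Proof.
have [n] := ubnP (absz (a + b + c + d)).
elim: n a b c d => // n IH a b c d ltn a0 b0 c0 d0 e.
have h : 0 < a /\ 0 < d by nia.
have [[ca db]|[[ca db]|[-> -> -> ->]]] :
    (c <= a /\ d <= b) \/ (a <= c /\ b <= d) \/
    [/\ a = 1, b = 0, c = 0 & d = 1].
- have [] := lerP c a; have [] := lerP d b; try by [left | right; left; lia].
  + move=> bd ca; have [->|nca] := eqVneq c a; first by right; left; lia.
    (* Now c < a and b < d, so 1 = ad - bc >= c + d, which leaves only the identity. *)
    right; right; have : 0 <= (a - c - 1) * d + (d - b - 1) * c by nia.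
    have -> : (a - c - 1) * d + (d - b - 1) * c = a * d - b * c - d - c by ring.
    rewrite e => dc.
    have [d1 c1] : d = 1 /\ c = 0 by lia.
    by subst d c; split=> //; lia.
  + by move=> db ac; nia.
- have [||||||w wE] := IH (a - c) (b - d) c d; try lia.
  exists (true :: w) => /=; rewrite -wE pslM //; last by lia.
  by congr psl; ring.
- have [||||||w wE] := IH a b (c - a) (d - b); try lia.
  exists (false :: w) => /=; rewrite -wE pslM //; last by lia.
  by congr psl; ring.
- by exists [::]; rewrite psl1.
Qed.

(** * Elements with positive entries *)

Definition pos (N : PSL2Z) : Prop := exists p q r s,
  [/\ [/\ 0 < p, 0 < q, 0 < r & 0 < s], p * s - q * r = 1 & N = psl p q r s].

Lemma posM N N' : pos N -> pos N' -> pos (N * N')%g.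
Proof.
move=> [p [q [r [s [[p0 q0 r0 s0] e ->]]]]].
move=> [p' [q' [r' [s' [[p0' q0' r0' s0'] e' ->]]]]].
rewrite pslM //; do 4!eexists; split; last by [].
  by rewrite !addr_gt0 ?mulr_gt0.
by rewrite -(mul1r 1) -{1}e -e'; ring.
Qed.

Lemma pos_neq1 N : pos N -> N <> 1%g.
Proof.
move=> [p [q [r [s [[p0 q0 r0 s0] e ->]]]]]; rewrite -psl1.
by move/psl_eqE => [] // []; lia.
Qed.

(** In the inverse, the off-diagonal entries have the sign opposite to that of the diagonal ones. *)
Lemma pos_asym N : pos N -> ~ pos N^-1%g.
Proof.
move=> [p [q [r [s [[p0 q0 r0 s0] e ->]]]]].
move=> [p' [q' [r' [s' [[p0' q0' r0' s0'] e' ]]]]].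
rewrite pslV //; move/psl_eqE => [] //; first by rewrite -e; ring.
- by case; lia.
- by case; lia.
Qed.

Lemma pos_expn N k : pos N -> pos (N ^+ k.+1)%g.
Proof. by move=> pN; elim: k => [//|k IH]; rewrite expgS; apply: posM. Qed.

(** Conjugation by [genS] yields the transpose of the inverse. *)
Lemma posS N : pos (N ^ genS)%g <-> pos N^-1%g.
Proof.
have [p [q [r [s [e ->]]]]] := pslP N.
rewrite pslV // genSE pslJ //.
have -> : 0 * (p * 0 + q * 1) - -1 * (r * 0 + s * 1) = s by ring.
have -> : 0 * (p * -1 + q * 0) - -1 * (r * -1 + s * 0) = - r by ring.
have -> : 0 * (r * 0 + s * 1) - 1 * (p * 0 + q * 1) = - q by ring.
have -> : 0 * (r * -1 + s * 0) - 1 * (p * -1 + q * 0) = p by ring.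
have e1 : s * p - - r * - q = 1 by rewrite -e; ring.
have e2 : s * p - - q * - r = 1 by rewrite -e; ring.
split.
  move=> [p' [q' [r' [s' [[p0 q0 r0 s0] e' /psl_eqE E]]]]].
  exists p', r', q', s'; split; [by []|by rewrite -e'; ring|].
  by have [[-> <- <- ->] //|[-> h1 h2 ->]] := E e1 e';
     rewrite h1 h2 -[RHS]pslN //; rewrite -e'; ring.
move=> [p' [q' [r' [s' [[p0 q0 r0 s0] e' /psl_eqE E]]]]].
exists p', r', q', s'; split; [by []|by rewrite -e'; ring|].
by have [[-> <- <- ->] //|[-> h1 h2 ->]] := E e2 e';
   rewrite h1 h2 -[RHS]pslN //; rewrite -e'; ring.
Qed.

(* Conjugation by [genR] turns [r] into the upper right entry [- r]. *)
Lemma posR N : pos N -> ~ pos (N ^ genR)%g.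
Proof.
move=> [p [q [r [s [[p0 q0 r0 s0] e ->]]]]]; rewrite genRE pslJ //.
move=> [p' [q' [r' [s' [[p0' q0' r0' s0'] e' /psl_eqE]]]]].
case=> //; first by rewrite -[RHS]e; ring.
- by case; lia.
- by case; lia.
Qed.

Lemma pos_ul N : pos N -> exists2 w, (0 < size w)%N & N = ul w.
Proof.
move=> pN; have [p [q [r [s [[p0 q0 r0 s0] e NE]]]]] := pN.
have [||||w wE] := nonneg_ul _ _ _ _ e; try exact: ltW.
exists w; last by rewrite NE.
by case: w wE => // wE; case: (pos_neq1 pN); rewrite NE wE.
Qed.

(** As a, d >= 1 and the trace exceeds 2, bc = ad - 1 is positive, so neither b nor c vanishes. *)
Lemma ul_pos w : hyperbolic (ul w) -> pos (ul w).
Proof.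
have [a [b [c [d [[a0 b0 c0 d0] e _ ->]]]]] := ul_nonneg w.
rewrite /hyperbolic /= abs_tr_psl // => h; exists a, b, c, d; split=> //.
have [a1 d1] : 0 < a /\ 0 < d by nia.
have bc : 0 < b * c by have := mulr_ge0 b0 c0; nia.
by split; nia.
Qed.

Lemma ul_neq1 w : (0 < size w)%N -> ul w <> 1%g.
Proof.
have [a [b [c [d [[a0 b0 c0 d0] e le_size ->]]]]] := ul_nonneg w.
by rewrite -psl1 => w0 /psl_eqE[] // []; lia.
Qed.

Lemma ul_neqS w : ul w <> genS.
Proof.
have [a [b [c [d [[a0 b0 c0 d0] e le_size ->]]]]] := ul_nonneg w.
by rewrite genSE => /psl_eqE[] // []; lia.
Qed.

(** * Reduction of forms *)

(** The form f(ax + by, cx + dy), a right action of matrices. *)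
Definition bqf_act (f : bqf) (a b c d : int) : bqf :=
  BQF (qA f * a * a + qB f * a * c + qC f * c * c)
      (2 * qA f * a * b + qB f * (a * d + b * c) + 2 * qC f * c * d)
      (qA f * b * b + qB f * b * d + qC f * d * d).

Lemma bqf_act1 f : bqf_act f 1 0 0 1 = f.
Proof. by case: f => A B C; rewrite /bqf_act /=; congr BQF; ring. Qed.

Lemma bqf_actM f a b c d a' b' c' d' :
  bqf_act (bqf_act f a b c d) a' b' c' d' =
  bqf_act f (a * a' + b * c') (a * b' + b * d')
            (c * a' + d * c') (c * b' + d * d').
Proof. by case: f => A B C; rewrite /bqf_act /=; congr BQF; ring. Qed.

Lemma disc_act f a b c d : a * d - b * c = 1 ->
  disc (bqf_act f a b c d) = disc f.
Proof.
move=> e; rewrite -[RHS]mulr1 -(mulr1 1) -e; case: f => A B C.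
by rewrite /disc /=; ring.
Qed.

Lemma square_disc_axis f : qA f * qC f = 0 -> square_disc f.
Proof. by move=> h; exists (qB f); rewrite /disc -mulrA h mulr0 subr0. Qed.

(** Gauss reduction, by descent on |A|. A translation makes |B| <= |A|; if AC is still positive,
    then 4AC = B^2 - disc < A^2, so |C| < |A| and exchanging A and C goes down. AC never vanishes,
    since the discriminant would be a square. *)
Lemma bqf_reduction f : indefinite f -> ~ square_disc f ->
  exists a b c d, [/\ a * d - b * c = 1, 0 < qA (bqf_act f a b c d) &
                      qC (bqf_act f a b c d) < 0].
Proof.
have [n] := ubnP (absz (qA f)); elim: n f => // n IH f ltn f0 fs.
have AC0 : qA f * qC f <> 0 by move=> /square_disc_axis.
(* Once AC < 0, the substitution S exchanges A and C if A is the negative one. *)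
have main g : qA g * qC g < 0 -> exists a b c d, [/\ a * d - b * c = 1,
    0 < qA (bqf_act g a b c d) & qC (bqf_act g a b c d) < 0].
  move=> AC; have [A0|A0] := lerP (qA g) 0.
    have C0 : 0 < qC g.
      by rewrite ltNge; apply/negP => C0; have := mulr_le0 A0 C0; lia.
    have {}A0 : qA g < 0 by case: (ltgtP (qA g) 0) A0 AC => // ->; lia.
    by exists 0, (-1), 1, 0; split=> //=; lia.
  exists 1, 0, 0, 1; rewrite bqf_act1; split=> //.
  by rewrite -(pmulr_rlt0 _ A0).
have comp g a b c d a' b' c' d' : g = bqf_act f a b c d -> a * d - b * c = 1 ->
    a' * d' - b' * c' = 1 -> 0 < qA (bqf_act g a' b' c' d') ->
    qC (bqf_act g a' b' c' d') < 0 ->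
    exists a b c d, [/\ a * d - b * c = 1, 0 < qA (bqf_act f a b c d) &
                      qC (bqf_act f a b c d) < 0].
  move=> -> e e'; rewrite bqf_actM => h h'; do 4!eexists; split; last 2 first.
  - exact: h.
  - exact: h'.
  - by rewrite -[RHS](mulr1 1) -{1}e -e'; ring.
have [lt0|] := ltrP (qA f * qC f) 0; first exact: main.
have A0 : qA f != 0 by apply/eqP => A0; rewrite A0 mul0r in AC0.
(* Adding |A| before the division by 2|A| centres the remainder at 0. *)
have [k Bk] : exists k, - `|qA f| <= qB f + 2 * qA f * k <= `|qA f|.
  have := divz_eq (qB f + `|qA f|) (2 * `|qA f|).
  have A2 : 2 * `|qA f| != 0 by lia.
  have := modz_ge0 (qB f + `|qA f|) A2; have := ltz_mod (qB f + `|qA f|) A2.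
  move: (_ %/ _)%Z (_ %% _)%Z => k m h1 h2 h3.
  have [A1|A1] := lerP 0 (qA f); [exists (- k)|exists k]; nia.
pose g := bqf_act f 1 k 0 1.
have gA : qA g = qA f by rewrite /g /=; ring.
have gB : qB g = qB f + 2 * qA f * k by rewrite /g /=; ring.
have gdisc : disc g = disc f by apply: disc_act; lia.
have gAC : qA g * qC g <> 0.
  by move=> /square_disc_axis [x xE]; apply: fs; exists x; rewrite -gdisc.
have e1 : 1 * 1 - k * 0 = 1 by lia.
move=> ge0; have [lt0|ge0'] := ltrP (qA g * qC g) 0.
  have [a [b [c [d [e h h']]]]] := main _ lt0.
  exact: (comp g _ _ _ _ _ _ _ _ erefl e1 e h h').
pose g' := bqf_act f k (-1) 1 0.
have g'E : g' = bqf_act g 0 (-1) 1 0.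
  by rewrite bqf_actM /g'; congr bqf_act; ring.
have g'disc : disc g' = disc f by apply: disc_act; ring.
have [|||a [b [c [d [e h h']]]]] := IH g'.
- have -> : qA g' = qC g by rewrite g'E /=; ring.
  move: f0; rewrite /indefinite -gdisc /disc gA gB => f0.
  suff : `|qC g| < `|qA f| by lia.
  rewrite gA in gAC ge0'.
  have : (qB f + 2 * qA f * k) ^+ 2 <= `|qA f| ^+ 2.
    rewrite -[X in X <= _](real_normK (num_real _)) lerXn2r // ?nnegrE //.
    lia.
  have ACE : qA f * qC g = `|qA f| * `|qC g| by rewrite -normrM ger0_norm.
  move=> hB; rewrite ltNge; apply/negP => hC.
  have : `|qA f| * `|qA f| <= `|qA f| * `|qC g| by rewrite ler_wpM2l.
  have : 4 * qA f * qC g = 4 * (`|qA f| * `|qC g|) by rewrite -ACE mulrA.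
  have := sqr_ge0 `|qA f|; move: f0 hB; lia.
- by rewrite /indefinite g'disc.
- by move=> [x xE]; apply: fs; exists x; rewrite -g'disc.
apply: (comp g' _ _ _ _ _ _ _ _ erefl _ e h h'); lia.
Qed.

(** For t >= 3, t^2 - 4 lies strictly between (t - 1)^2 and t^2. *)
Lemma sqr_trace_subr4 t u : 2 < t -> t ^+ 2 - 4 <> u ^+ 2 :> int.
Proof.
move=> t2 E.
have {E} : t ^+ 2 - 4 = `|u| ^+ 2 by rewrite (real_normK (num_real _)).
have := normr_ge0 u; move: `|u| => v v0 E.
have [h|h] := lerP t v; first by nia.
have : v <= t - 1 by lia.
by nia.
Qed.

(** Conjugating the matrix amounts to substituting in the form (r, s - p, -q), so A and -C are the
    new off-diagonal entries. If both are positive, so is the product of the diagonal entries, and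
    the trace settles their common sign. *)
Lemma posJP p q r s a b c d :
  p * s - q * r = 1 -> a * d - b * c = 1 -> 2 < p + s ->
  let f := bqf_act (BQF r (s - p) (- q)) a b c d in
  pos (psl p q r s ^ psl a b c d)%g <-> 0 < qA f /\ qC f < 0.
Proof.
move=> e e' t2 f; rewrite pslJ //.
set p' := d * _ - _; set q' := d * _ - _.
set r' := a * _ - _; set s' := a * _ - _.
have t : p' + s' = p + s by rewrite -[RHS]mulr1 -e' /p' /s'; ring.
have det : p' * s' - q' * r' = 1.
  have e3 : d * a - - b * - c = 1 by rewrite -e'; ring.
  by rewrite -[RHS](det_mul e3 (det_mul e e')) /p' /q' /r' /s'; ring.
have -> : qA f = r' by rewrite /f /r' /=; ring.
have -> : qC f = - q' by rewrite /f /q' /=; ring.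
move: p' q' r' s' t det => p' q' r' s' t det.
split=> [[p1 [q1 [r1 [s1 [[p0 q0 r0 s0] e1 /psl_eqE E]]]]]|[hr hq]].
  by have [[*]|[*]] := E det e1; lia.
rewrite oppr_lt0 in hq.
have ps0 : 0 < p' * s' by have := mulr_gt0 hr hq; lia.
have p0 : 0 < p'.
  rewrite ltNge; apply/negP => p0.
  by have := mulr_le0_ge0 p0 (_ : 0 <= s'); lia.
have s0 : 0 < s' by rewrite -(pmulr_rgt0 _ p0).
by exists p', q', r', s'; split=> //; split=> //; lia.
Qed.

(** The form (r, s - p, -q) has discriminant (p + s)^2 - 4, positive and not a square, so reduction
    applies. *)
Lemma hyperbolic_pos M : hyperbolic M -> exists W, pos (M ^ W)%g.
Proof.
move=> /hyperbolicP[p [q [r [s [e t2 ->]]]]].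
pose f := BQF r (s - p) (- q).
have fD : disc f = (p + s) ^+ 2 - 4 by rewrite /disc /= !expr2; lia.
have [||a [b [c [d [e' h h']]]]] := @bqf_reduction f.
- by rewrite /indefinite fD; nia.
- by move=> [u uE]; apply: (@sqr_trace_subr4 _ u t2); rewrite -fD.
by exists (psl a b c d); rewrite posJP.
Qed.

(** * Positive conjugates of one element *)

Lemma pos_trace (p q r s : int) : 0 < p -> 0 < q -> 0 < r -> 0 < s ->
  p * s - q * r = 1 -> 2 < p + s.
Proof.
move=> p0 q0 r0 s0 e; rewrite ltNge; apply/negP => le2.
have [p1 s1] : p = 1 /\ s = 1 by lia.
by subst p s; have := mulr_gt0 q0 r0; lia.
Qed.

(* The axis of [N] crosses the geodesic from 0 to infinity and its image under
   [V] in the same direction; as these do not cross each other, one of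
   [V], [V^-1] maps the positive half-line into itself. *)
Lemma pos_conj_ul N V : pos N -> pos (N ^ V)%g ->
  exists w, V = ul w \/ V^-1%g = ul w.
Proof.
move=> [p [q [r [s [[p0 q0 r0 s0] e ->]]]]].
have t2 := pos_trace p0 q0 r0 s0 e.
have [a [b [c [d [e' ->]]]]] := pslP V.
move=> /(posJP e e' t2) /= [hA hC].
wlog a0 : a b c d e' hA hC / 0 <= a.
  move=> W; have [|a0] := lerP 0 a; first exact: W.
  rewrite -pslN //; apply: W; rewrite ?mulrNN //; last by lia.
  - by move: hA; congr (_ < _); ring.
  - by move: hC; congr (_ < _); ring.
have {}a0 : 0 < a.
  rewrite lt_def a0 andbT; apply/eqP => aE; move: hA; rewrite aE.
  by have := mulr_ge0 (ltW q0) (sqr_ge0 c); rewrite expr2; lia.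
rewrite pslV //.
(* If bc >= 0, then d > 0 and b, c do not have opposite signs: V or its inverse has nonnegative
   entries. *)
have [bc|bc] := lerP 0 (b * c).
  have d0 : 0 < d by rewrite -(pmulr_rgt0 _ a0); lia.
  have [b0|b0] := lerP 0 b.
    have [c0|c0] := lerP 0 c.
      by have [w ->] := nonneg_ul (ltW a0) b0 c0 (ltW d0) e'; exists w; left.
    have {}b0 : b = 0 by nia.
    subst b; have [|||||w ->] := @nonneg_ul d (- 0) (- c) a; try lia.
    by exists w; right.
  have c0 : c <= 0 by rewrite -(nmulr_rge0 _ b0).
  have [|||||w ->] := @nonneg_ul d (- b) (- c) a; try lia.
  by exists w; right.
exfalso.
have d0 : d < 0.
  have : d <= 0 by rewrite -(pmulr_rle0 _ a0); lia.
  rewrite le_eqVlt => /orP[/eqP dE|//]; move: hC; rewrite dE.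
  by have := mulr_ge0 (ltW r0) (sqr_ge0 b); rewrite expr2; lia.
pose fA := r * a * a + (s - p) * a * c + - q * c * c.
pose fC := r * b * b + (s - p) * b * d + - q * d * d.
(* As bc < 0 and d < 0, the two sides of this identity have opposite signs. *)
have key : fA * (b * d) - fC * (a * c) = r * (a * b) + q * (c * d).
  by rewrite -[RHS]mulr1 -e' /fA /fC; ring.
move: hA hC; rewrite -/fA -/fC; move: fA fC key => fA fC key hA hC.
have [b0|b0] := ltrP b 0.
  have c0 : 0 < c by rewrite -(nmulr_rlt0 _ b0).
  have := mulr_gt0 hA (mulr_gt0 (_ : 0 < - b) (_ : 0 < - d)).
  have := mulr_gt0 (_ : 0 < - fC) (mulr_gt0 a0 c0).
  have := mulr_gt0 r0 (mulr_gt0 a0 (_ : 0 < - b)).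
  have := mulr_gt0 q0 (mulr_gt0 c0 (_ : 0 < - d)).
  by rewrite !oppr_gt0 => /(_ d0) h1 /(_ b0) h2 /(_ hC) h3 /(_ b0 d0) h4; lia.
have {}b0 : 0 < b.
  by rewrite lt_def b0 andbT; apply/eqP => bE; rewrite bE mul0r in bc.
have c0 : c < 0 by rewrite -(pmulr_rlt0 _ b0).
have := mulr_gt0 hA (mulr_gt0 b0 (_ : 0 < - d)).
have := mulr_gt0 (_ : 0 < - fC) (mulr_gt0 a0 (_ : 0 < - c)).
have := mulr_gt0 r0 (mulr_gt0 a0 b0).
have := mulr_gt0 q0 (mulr_gt0 (_ : 0 < - c) (_ : 0 < - d)).
by rewrite !oppr_gt0 => /(_ c0 d0) h1 h2 /(_ hC c0) h3 /(_ d0) h4; lia.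
Qed.

(** Otherwise no two coefficients of the form of [N ^ letter x] have opposite signs, and a
    substitution with nonnegative entries cannot produce A > 0 > C from it. *)
Lemma pos_conj_letter N x w : pos N -> pos (N ^ (letter x * ul w))%g ->
  pos (N ^ letter x)%g.
Proof.
move=> [p [q [r [s [[p0 q0 r0 s0] e ->]]]]].
have t2 := pos_trace p0 q0 r0 s0 e.
have [a [b [c [d [[a0 b0 c0 d0] e' _ ->]]]]] := ul_nonneg w.
case: x => /=; rewrite pslM //; move=> /posJP [||//|/= hA hC];
  rewrite ?posJP //=; try lia.
  split; [lia|]; rewrite ltNge; apply/negP => h.
  have := mulr_ge0 (ltW r0) (mulr_ge0 b0 b0).
  have : 0 <= 2 * r + (s - p) by lia.
  move=> /mulr_ge0 /(_ (mulr_ge0 b0 d0)).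
  have := mulr_ge0 h (mulr_ge0 d0 d0); lia.
split; [|lia]; rewrite ltNge; apply/negP => h.
have := mulr_ge0 (ltW q0) (mulr_ge0 c0 c0).
have : 0 <= 2 * q - (s - p) by lia.
move=> /mulr_ge0 /(_ (mulr_ge0 a0 c0)).
have : 0 <= - (r + (s - p) - q) by lia.
move=> /mulr_ge0 /(_ (mulr_ge0 a0 a0)); lia.
Qed.

(* The edges of the axis of [M] which [M] traverses from their ⊗-end to their
   •-end are connected by steps along the axis. *)
Lemma pos_connected (P : PSL2Z -> Prop) M :
  (forall W x, pos (M ^ W)%g -> pos (M ^ (W * letter x))%g ->
     P W <-> P (W * letter x)%g) ->
  forall W W', pos (M ^ W)%g -> pos (M ^ W')%g -> P W <-> P W'.
Proof.
move=> step.
have H W w : pos (M ^ W)%g -> pos (M ^ (W * ul w))%g -> P W <-> P (W * ul w)%g.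
  elim: w W => [|x w IH] W pW; first by rewrite mulg1.
  move=> /= pW'; have pWx : pos (M ^ (W * letter x))%g.
    by rewrite conjgM; apply: (@pos_conj_letter _ _ w); rewrite -?conjgM.
  by rewrite (step _ _ pW pWx) mulgA; apply: IH; rewrite -?mulgA.
move=> W W' pW pW'.
have [|w [wE|wE]] := @pos_conj_ul (M ^ W)%g (W^-1 * W')%g pW.
- by rewrite -conjgM mulVKg.
- by rewrite -(mulVKg W W') wE; apply: H; rewrite // -wE mulVKg.
- rewrite invgM invgK in wE.
  by rewrite -(mulVKg W' W) wE; symmetry; apply: H; rewrite // -wE mulVKg.
Qed.

(** * Axes *)

Lemma farey_bendP (W W' : edge farey) :
  bend W = bend W' <-> [\/ W' = W, W' = (W * genR)%g | W' = (W * genR^-1)%g].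
Proof.
rewrite [X in X <-> _]farey_nextP -farey_b_eq genRV; split=> [E|[] ->].
- have : farey_b W W' by rewrite E; left; left.
  by case=> [[->|->]|->]; [constructor 1|constructor 2|constructor 3].
- by [].
- by rewrite farey_b_next.
- by rewrite mulgA !farey_b_next.
Qed.

Lemma farey_w_S W : farey_w (W * genS)%g = farey_w W.
Proof. by rewrite /farey_w -mulgA genSS mulg1 setUC. Qed.

Lemma farey_wendP (W W' : edge farey) :
  wend W = wend W' <-> W' = W \/ W' = (W * genS)%g.
Proof.
split=> [/(congr1 val) /= E|[] -> //].
  by have : farey_w W W' by rewrite E; left.
by apply: val_inj; rewrite /= farey_w_S.
Qed.

Lemma genS_neqR : genS <> genR /\ genS <> genR^-1%g.
Proof.
by rewrite genSE genRE pslV //; split=> /psl_eqE[] // [].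
Qed.

Lemma int_parity (n : int) : exists k : int, n = 2 * k \/ n = 2 * k + 1.
Proof. by exists (n %/ 2)%Z; lia. Qed.

Lemma int_ind_iff (P : int -> Prop) :
  P 0 -> (forall n, P n <-> P (n + 1)) -> forall n, P n.
Proof.
move=> P0 PS; have Pn (n : nat) : P n.
  elim: n => // n; rewrite PS; suff -> : n.+1%:Z = n%:Z + 1 by []; lia.
case=> n //; elim: n => [|n IH]; first by rewrite PS.
by rewrite PS; suff -> : Negz n.+1 + 1 = Negz n by []; lia.
Qed.

(** Injectivity forbids repeating an edge, which leaves R or R^-1 at the •-end and S at the ⊗-end;
    together they make a letter. *)
Lemma line_step (g : int -> edge farey) (n : int) : is_line g ->
  exists2 x, g (2 * n + 2) = (g (2 * n)%R * letter x)%g &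
             g (2 * n + 1) = (g (2 * n + 2)%R * genS)%g.
Proof.
move=> [gI gV]; have [/farey_bendP gb /farey_wendP gw] := gV n.
have g2 : g (2 * n + 2) = (g (2 * n + 1)%R * genS)%g.
  by case: gw => // /gI; lia.
rewrite g2 -mulgA genSS mulg1.
case: gb => E; first by have := gI _ _ E; lia.
- by exists true; rewrite //= E -mulgA -genUE.
- by exists false; rewrite //= E -mulgA -genLE.
Qed.

Lemma line_word (g : int -> edge farey) (n : int) (k : nat) : is_line g ->
  exists w, g (2 * n + 2 * k) = (g (2 * n)%R * ul w)%g.
Proof.
move=> gl; elim: k => [|k [w IH]].
  by exists [::]; rewrite mulr0 addr0 /= mulg1.
have [x] := line_step (n + k) gl.
have -> : 2 * (n + k%:Z) = 2 * n + 2 * k by lia.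
have -> : 2 * n + 2 * k%:Z + 2 = 2 * n + 2 * k.+1 by lia.
by rewrite IH => -> _; exists (w ++ [:: x]); rewrite ul_cat /= mulg1 mulgA.
Qed.

(** Left multiplication preserves the type of the vertex between consecutive edges, ⊗ for a step by
    S and • for a step by R or R^-1; an odd shift would exchange the types. *)
Lemma translation_even (M : PSL2Z) (g : int -> edge farey) (l : int) :
  is_line g -> (forall n : int, (M * g n)%g = g (n + l)) -> exists k, l = 2 * k.
Proof.
move=> gl Mg; have [k [->|lE]] := int_parity l; exists k => //; exfalso.
have [x _ g1] := line_step k gl; have [gI /(_ 0)[/farey_bendP gb _]] := gl.
have E : g (2 * 0 + 1) = (g (2 * 0)%R * genS)%g.
  apply: (@mulgI _ M); rewrite mulgA !Mg lE.
  have -> : 2 * 0 + 1 + (2 * k + 1) = 2 * k + 2 by lia.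
  have -> : 2 * 0 + (2 * k + 1) = 2 * k + 1 by lia.
  by rewrite g1 -mulgA genSS mulg1.
case: gb => E'; first by have := gI _ _ E'.
- by case: genS_neqR => [+ _]; apply; apply: (@mulgI _ (g (2 * 0))); rewrite -E.
- by case: genS_neqR => [_]; apply; apply: (@mulgI _ (g (2 * 0))); rewrite -E.
Qed.

Lemma translates_pos M (g : int -> edge farey) (n : int) :
  hyperbolic M -> translates M g -> pos (M ^ g (2 * n)%R)%g.
Proof.
move=> hM [gl [l l0 Mg]]; have [k lE] := translation_even gl Mg.
have [w wE] := line_word n (absz k) gl.
have E : (M ^ g (2 * n)%R = ul w)%g.
  by apply: (@mulgI _ (g (2 * n))); rewrite -wE -conjgC Mg; congr g; lia.
by rewrite E; apply: ul_pos; rewrite -E; apply: hyperbolicJ.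
Qed.

Lemma seq_of_steps (T : groupType) (x : T) (A : int -> T) :
  exists2 h : int -> T, h 0 = x & forall n, h (n + 1) = (h n * A n)%g.
Proof.
pose hp := fix hp (n : nat) := if n is m.+1 then (hp m * A m)%g else x.
pose hn := fix hn (n : nat) :=
  if n is m.+1 then (hn m * (A (Negz m))^-1)%g else x.
exists (fun n => match n with Posz m => hp m | Negz m => hn m.+1 end) => //.
case=> [n|[|n]].
- by have -> : n%:Z + 1 = n.+1 by lia.
- by rewrite /= mulgVK.
- have -> : Negz n.+1 + 1 = Negz n by lia.
  by rewrite /= mulgVK.
Qed.

(** Starting from W, the word of [M ^ W] is repeated periodically in both directions; M then shifts
    the line by one period. *)
Lemma axis_line M W : pos (M ^ W)%g ->
  exists2 g, translates M g & g 0 = W.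
Proof.
move=> pW; have [w w0 wE] := pos_ul pW; set m := (size w)%:Z.
(* The remainder lies in [0, m), so the default of [nth] is never reached. *)
pose A (n : int) := letter (nth true w (absz (n %% m)%Z)).
have [h h0 hS] := seq_of_steps W A.
have hw n k : exists2 v, size v = k & h (n + k%:Z) = (h n * ul v)%g.
  elim: k => [|k [v vk IH]].
    by exists [::]; rewrite // addr0 mulg1.
  have -> : n + k.+1%:Z = n + k%:Z + 1 by lia.
  rewrite hS IH; exists (rcons v (nth true w (absz ((n + k%:Z) %% m)%Z))).
    by rewrite size_rcons vk.
  by rewrite -cats1 ul_cat /= mulg1 mulgA.
have hprefix k : (k <= size w)%N -> h k%:Z = (W * ul (take k w))%g.
  elim: k => [|k IH] lk; first by rewrite take0 mulg1.
  have -> : k.+1%:Z = k%:Z + 1 by lia.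
  rewrite hS IH ?(ltnW lk) // (take_nth true) // -cats1 ul_cat /= mulg1 -mulgA.
  by rewrite /A modz_small.
(* At 0 this is M W = W (M ^ W); afterwards both sides take the same steps, by periodicity. *)
have Mh n : (M * h n)%g = h (n + m).
  elim/int_ind_iff: n => [|n].
    by rewrite h0 add0r hprefix // take_size -wE -conjgC.
  have -> : n + 1 + m = n + m + 1 by lia.
  rewrite !hS {2}/A modzDr -/(A n) mulgA; split=> [->//|]; exact: mulIg.
have hneq n k : (0 < k)%N -> h (n + k%:Z) <> h n.
  move=> k0; have [v vk ->] := hw n k; rewrite -[X in _ <> X]mulg1 => /mulgI.
  by apply: ul_neq1; rewrite vk.
have hI : injective h.
  move=> i j E; have [ij|ij|//] := ltgtP i j; exfalso.
  - apply: (hneq i (absz (j - i))); first by lia.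
    by have -> : i + (absz (j - i))%:Z = j by lia.
  - apply: (hneq j (absz (i - j))); first by lia.
    by have -> : j + (absz (i - j))%:Z = i by lia.
(* An even and an odd edge could coincide only if S were a word. *)
have hnS i j : h i <> (h j * genS)%g.
  move=> E; have [ij|/ltW ij] := lerP j i.
    have [v _] := hw j (absz (i - j)).
    have -> : j + (absz (i - j))%:Z = i by lia.
    by rewrite E => /mulgI /esym; apply: ul_neqS.
  have [v _] := hw i (absz (j - i)).
  have -> : i + (absz (j - i))%:Z = j by lia.
  have -> : h j = (h i * genS)%g by rewrite E -mulgA genSS mulg1.
  by move=> /mulgI /esym; apply: ul_neqS.
(* Even places carry h n; the odd place before h (n + 1) carries the other edge at its ⊗-vertex. *)
pose g n := if (n %% 2)%Z == 0 then h (n %/ 2)%Z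
  else (h ((n %/ 2)%Z + 1) * genS)%g.
have g0 n : g (2 * n) = h n.
  rewrite /g; have -> : ((2 * n) %% 2)%Z = 0 by lia.
  by rewrite eqxx; congr h; lia.
have g1 n : g (2 * n + 1) = (h (n + 1) * genS)%g.
  rewrite /g; have -> : ((2 * n + 1) %% 2)%Z = 1 by lia.
  by rewrite /=; congr (h (_ + _) * _)%g; lia.
exists (g : int -> edge farey); last by rewrite -(mulr0 2) g0.
split; last first.
  exists (2 * m) => [|n]; first by lia.
  have [k [->|->]] := int_parity n.
    by rewrite -mulrDr !g0 Mh.
  have -> : 2 * k + 1 + 2 * m = 2 * (k + m) + 1 by lia.
  by rewrite !g1 mulgA Mh; congr (h _ * _)%g; lia.
split=> [i j|n].
  have [k [->|->]] := int_parity i; have [k' [->|->]] := int_parity j;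
    rewrite ?g0 ?g1.
  - by move/hI->.
  - by move/hnS.
  - by move/esym/hnS.
  - by move/mulIg/hI => E; congr (_ + _); lia.
split.
  apply/farey_bendP; rewrite g0 g1 hS /A; case: (nth _ _ _) => /=.
    by constructor 2; rewrite genUE -!mulgA genSS mulg1.
  by constructor 3; rewrite genLE -!mulgA genSS mulg1.
apply/farey_wendP; right.
have -> : 2 * n + 2 = 2 * (n + 1) by lia.
by rewrite g0 g1 -mulgA genSS mulg1.
Qed.

Lemma axis_posP M W : hyperbolic M -> axis_pos M W <-> pos (M ^ W)%g.
Proof.
move=> hM; split=> [[g tg [n ->]]|/axis_line[g tg gW]].
  exact: translates_pos.
by exists g => //; exists 0; rewrite mulr0.
Qed.

(** The odd edges of a line are the even ones times S, and conjugation by S exchanges positivity of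
    an element and of its inverse. *)
Lemma axisP M W : hyperbolic M ->
  axis M W <-> pos (M ^ W)%g \/ pos (M ^ W)^-1%g.
Proof.
move=> hM; rewrite -posS -conjgM; split=> [[g tg [n ->]]|[]/axis_line[g tg gW]].
- have [gl _] := tg; have [k [->|->]] := int_parity n.
    by left; apply: translates_pos.
  have [x _ ->] := line_step k gl; right.
  rewrite -mulgA genSS mulg1; have -> : 2 * k + 2 = 2 * (k + 1) by lia.
  exact: translates_pos.
- by exists g => //; exists 0.
- have [gl _] := tg; exists g => //; exists (-1).
  have [x _ ->] := line_step (-1) gl; rewrite [X in g X](_ : _ = 0) //.
  by rewrite gW -mulgA genSS mulg1.
Qed.

(** * Orientations *)

(** Hence positivity of [M ^ W] depends only on the image of W in the çark. *)
Lemma conj_cyc M h W : cyc M h -> (M ^ (h * W) = M ^ W)%g.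
Proof.
move=> Mh; rewrite conjgM; congr (_ ^ _)%g; apply/conjg_fixP/commgP.
by case: Mh => n [->|->]; [|apply: commuteV]; apply: commuteX.
Qed.

Lemma cark_projP M W W' :
  cark_proj M W = cark_proj M W' <-> exists2 h, cyc M h & W' = (h * W)%g.
Proof.
split=> [/(congr1 val) /= E|[h Mh ->]]; last by rewrite cark_proj_eq.
have : edge_orbit M W W'.
  by rewrite E; exists 1%g; rewrite ?mul1g //; exact: cyc1.
by case=> h Mh <-; exists h.
Qed.

Lemma conj_cark_proj M W W' :
  cark_proj M W = cark_proj M W' -> (M ^ W' = M ^ W)%g.
Proof. by move=> /cark_projP[h Mh ->]; exact: conj_cyc. Qed.

Lemma cark_bendP M W W' :
  cark_bend (cark_proj M W) = cark_bend (cark_proj M W') <->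
  [\/ cark_proj M W' = cark_proj M W, cark_proj M W' = cark_proj M (W * genR)%g |
      cark_proj M W' = cark_proj M (W * genR^-1)%g].
Proof.
rewrite cark_nextP; split=> [[n]|].
  rewrite cark_iter_next; set V := iter _ _ _.
  have /farey_bendP : @bend farey W = @bend farey V.
    by apply/farey_nextP; exists n.
  by case=> -> ->; [constructor 1|constructor 2|constructor 3].
case=> ->; [exists 0%N|exists 1%N|exists 2%N] => //; rewrite cark_iter_next //=.
by rewrite -mulgA -genRV.
Qed.

Lemma cark_wendP M W W' :
  cark_wend (cark_proj M W) = cark_wend (cark_proj M W') <->
  cark_proj M W' = cark_proj M W \/ cark_proj M W' = cark_proj M (W * genS)%g.
Proof.
split=> [/(congr1 val) /= E|[] -> //].
  have : (farey_w @` edge_orbit M W') (farey_w W').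
    by exists W' => //; exists 1%g; rewrite ?mul1g //; exact: cyc1.
  rewrite -E => -[_ [h Mh <-]] /= hE.
  have : farey_w (h * W)%g W' by rewrite hE; left.
  by case=> ->; [left|right]; rewrite -?mulgA (cark_proj_eq _ Mh).
apply: val_inj; rewrite /= !edge_orbitE ?farey_w_S //; exact: farey_w_lact.
Qed.

(** A conjugate of M is positive, and so are its powers. *)
Lemma hyperbolic_expg_neq1 M n : hyperbolic M -> (M ^+ n.+1)%g <> 1%g.
Proof.
move=> /hyperbolic_pos[W pW] E.
by apply: (pos_neq1 (pos_expn n pW)); rewrite -conjXg E conj1g.
Qed.

(** Otherwise a conjugate of S, of order 2, would be a power of M, whose order is infinite. So the
    two edges at a ⊗-vertex stay distinct in the çark. *)
Lemma cark_proj_neqS M W : hyperbolic M ->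
  cark_proj M W <> cark_proj M (W * genS)%g.
Proof.
move=> hM /cark_projP[h Mh E].
have hh : (h * h = 1)%g.
  by apply: (@mulIg _ W); rewrite mul1g -mulgA -E mulgA -E -mulgA genSS mulg1.
case: Mh => -[|n] hE.
  have h1 : h = 1%g by case: hE => ->; rewrite ?expg0 ?invg1.
  by apply: (@ul_neqS [::]); apply: (@mulgI _ W); rewrite E h1 mulg1 mul1g.
apply: (@hyperbolic_expg_neq1 M (n + n.+1)%N hM).
rewrite -addSn expgnDr; case: hE hh => -> //.
by rewrite -invgM => /eqP; rewrite invg_eq1 => /eqP.
Qed.

Definition in_axis (N : PSL2Z) : Prop := pos N \/ pos N^-1%g.

Lemma in_axis_flip N X : X = genR \/ X = (genR^-1)%g \/ X = genS ->
  in_axis N -> in_axis (N ^ X)%g -> pos N <-> ~ pos (N ^ X)%g.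
Proof.
move=> XE aN aNX; split.
  move=> pN; case: XE => [->|[->|->]].
  - exact: posR.
  - by move/posR; rewrite -conjgM mulVg conjg1.
  - by move/posS; apply: pos_asym.
(* What remains is to exclude that both inverses are positive. *)
move=> npX; case: aN => // pN; case: aNX => // pX; exfalso.
case: XE => XE; last case: XE => XE.
- by apply: (posR pN); rewrite -XE conjVg.
- by apply: (posR pX); rewrite XE -conjVg -conjgM mulVg conjg1.
- by apply: npX; rewrite XE; apply/posS.
Qed.

Lemma spineP M W : hyperbolic M ->
  spine M (cark_proj M W) <-> in_axis (M ^ W)%g.
Proof.
move=> hM; split=> [[V /(axisP _ hM) aV] /conj_cark_proj ->//|aW].
by exists W => //; apply/axisP.
Qed.

Lemma cark_dirP M W : hyperbolic M ->
  cark_dir (cark_of M) (cark_proj M W) <-> pos (M ^ W)%g.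
Proof.
move=> hM; split=> [[V /(axis_posP _ hM) pV] /conj_cark_proj ->//|pW].
by exists W => //; apply/axis_posP.
Qed.

Lemma oriented_cark_of M : hyperbolic M -> oriented_cark (cark_of M).
Proof.
move=> hM; split=> //; split.
  move=> e; have [W ->] := cark_edgeP e => /(cark_dirP _ hM) pW.
  by apply/spineP => //; left.
move=> e e'; have [[W ->] [W' ->]] := (cark_edgeP e, cark_edgeP e').
move=> /(spineP _ hM) aW /(spineP _ hM) aW' neq.
rewrite !cark_dirP // => adj.
have [X XE E] : exists2 X, X = genR \/ X = (genR^-1)%g \/ X = genS &
    cark_proj M W' = cark_proj M (W * X)%g.
  case: adj => [/cark_bendP|/cark_wendP] []; try by move/esym/neq.
  - by exists genR; auto.
  - by exists (genR^-1)%g; auto.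
  - by exists genS; auto.
rewrite -(conj_cark_proj E) conjgM in aW' *.
by apply: in_axis_flip XE _ _.
Qed.

Lemma orientation_cases M (O : set (edge (cark_graph M))) : hyperbolic M ->
  is_orientation (spine M) O ->
  (forall W, O (cark_proj M W) <-> pos (M ^ W)%g) \/
  (forall W, O (cark_proj M W) <-> pos (M ^ W)^-1%g).
Proof.
move=> hM [Osub Oalt].
have flip W V : pos (M ^ W)%g -> pos (M ^ V)^-1%g ->
    cark_bend (cark_proj M W) = cark_bend (cark_proj M V) \/
    cark_wend (cark_proj M W) = cark_wend (cark_proj M V) ->
    (O (cark_proj M W) <-> ~ O (cark_proj M V)) /\
    (O (cark_proj M V) <-> ~ O (cark_proj M W)).
  move=> pW pV adj.
  have sW : spine M (cark_proj M W) by apply/spineP => //; left.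
  have sV : spine M (cark_proj M V) by apply/spineP => //; right.
  have neq : cark_proj M W <> cark_proj M V.
    by move/conj_cark_proj => E; rewrite E in pV; apply: (pos_asym pW).
  split; apply: Oalt => //; first exact/nesym.
  by case: adj => E; [left|right]; exact: esym.
have posO W W' : pos (M ^ W)%g -> pos (M ^ W')%g ->
    O (cark_proj M W) <-> O (cark_proj M W').
  move=> pW; apply: (pos_connected (P := fun W => O (cark_proj M W))) => //.
  (* V is the edge of the axis between W and [W * letter x], traversed the opposite way, so
     membership in O flips twice. *)
  move=> {pW}W x pW pWx; pose V := (W * letter x * genS)%g.
  have pV : pos (M ^ V)^-1%g.
    by apply/posS; rewrite -conjgM /V -mulgA genSS mulg1.
  have [|-> _] := @flip W V pW pV.
    left; apply/cark_bendP; rewrite /V -mulgA; case: x {pWx pV V} => /=.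
      by constructor 2; rewrite genUE -mulgA genSS mulg1.
    by constructor 3; rewrite genLE -mulgA genSS mulg1.
  have [|-> _ //] := @flip (W * letter x)%g V pWx pV.
  by right; apply/cark_wendP; right.
have negS W : pos (M ^ W)^-1%g -> pos (M ^ (W * genS))%g.
  by rewrite conjgM posS.
have flipS W : pos (M ^ W)^-1%g ->
    O (cark_proj M W) <-> ~ O (cark_proj M (W * genS)%g).
  move=> nW; have [|_ //] := @flip (W * genS)%g W (negS W nW) nW.
  by right; apply/esym/cark_wendP; right.
(* The value of O at one positive edge decides; negative edges are compared with it through S. *)
have [W0 pW0] := hyperbolic_pos hM.
have [OW0|nOW0] := pselect (O (cark_proj M W0)); [left|right] => W; split.
- move=> OW; have /Osub /(spineP _ hM) [//|nW] := OW.
  move/(flipS W nW): OW; case; apply/(posO W0) => //; exact: negS.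
- by move=> pW; apply/(posO W0).
- move=> OW; have /Osub /(spineP _ hM) [pW|//] := OW.
  by case: nOW0; apply/(posO W).
- move=> nW; apply/(flipS W nW) => OWS; apply: nOW0.
  by apply/(posO (W * genS)%g) => //; exact: negS.
Qed.

(** * Isomorphisms of çarks *)

(** The condition V<M'>V^-1 = <M>, under which left multiplication by V descends to a map from the
    çark of M' to that of M. *)
Definition cyc_conj (M' M V : PSL2Z) : Prop :=
  forall h, cyc M' h <-> cyc M (h ^ V^-1)%g.

Lemma cyc_conjV M' M V : cyc_conj M' M V -> cyc_conj M M' V^-1%g.
Proof. by move=> H h; rewrite H -conjgM invgK mulgV conjg1. Qed.

Lemma cyc_conjJ M V : cyc_conj (M ^ V)%g M V.
Proof.
move=> h; split=> -[n hE]; exists n.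
  by case: hE => ->; [left|right]; rewrite ?conjVg -conjXg -conjgM mulgV conjg1.
by case: hE => hE; [left|right];
  rewrite -conjXg -?conjVg -hE -conjgM mulVg conjg1.
Qed.

Lemma cyc_inv M h : cyc M^-1%g h <-> cyc M h.
Proof.
by split=> -[n [->|->]]; exists n; rewrite expVgn ?invgK;
  [right|left|right|left].
Qed.

Lemma lactK V A : lact V^-1%g (lact V A) = A.
Proof.
rewrite /lact image_comp -[RHS]image_id; apply: eq_imagel => W _ /=.
exact: mulKg.
Qed.
Lemma lactVK V A : lact V (lact V^-1%g A) = A.
Proof. by rewrite -{1}[V]invgK lactK. Qed.

Lemma lactM V W A : lact V (lact W A) = lact (V * W)%g A.
Proof.
by rewrite /lact image_comp; apply: eq_imagel => x _ /=; rewrite mulgA.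
Qed.

(** An arbitrary action is allowed so as to cover both edges and vertices, the latter being sets of
    edges. *)
Lemma lact_orbit M' M V (H : cyc_conj M' M V) (X : Type)
    (act : PSL2Z -> X -> X) (x : X) :
  (forall h k x, act h (act k x) = act (h * k)%g x) ->
  act V @` [set act h x | h in cyc M'] = [set act h (act V x) | h in cyc M].
Proof.
move=> actM; apply/seteqP; split=> [_ [_ [h /H Mh <-] <-]|_ [h Mh <-]] /=.
  exists (h ^ V^-1)%g => //.
  by rewrite !actM -conjgCV.
have M'h : cyc M' (h ^ V)%g by rewrite H -conjgM mulgV conjg1.
by exists (act (h ^ V)%g x); [exists (h ^ V)%g|rewrite !actM (conjgC h V)].
Qed.

Lemma lact_edge_orbit M' M V (H : cyc_conj M' M V) W :
  lact V (edge_orbit M' W) = edge_orbit M (V * W)%g.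
Proof.
by apply: (lact_orbit H (act := fun h W => (h * W)%g)) => *; rewrite mulgA.
Qed.

Lemma tr_edge_subproof M' M V (H : cyc_conj M' M V) (e : cark_edge M') :
  range (edge_orbit M) (lact V (val e)).
Proof.
by have [W ->] := cark_edgeP e; exists (V * W)%g; rewrite ?(lact_edge_orbit H).
Qed.
Definition tr_edge M' M V (H : cyc_conj M' M V) (e : cark_edge M') :
  cark_edge M := SigSub (mem_set (tr_edge_subproof H e)).

Lemma tr_edge_proj M' M V (H : cyc_conj M' M V) W :
  tr_edge H (cark_proj M' W) = cark_proj M (V * W)%g.
Proof. by apply: val_inj; exact: lact_edge_orbit. Qed.

Lemma tr_vtx_subproof M' M V (H : cyc_conj M' M V) (f : PSL2Z -> set PSL2Z)
    (fE : forall h W, f (h * W)%g = lact h (f W))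
    (v : [set vtx_orbit M' v | v in range f]) :
  [set vtx_orbit M v | v in range f] (lact V @` val v).
Proof.
have /set_mem[_ [W _ <-] <-] := valP v.
exists (f (V * W)%g); first by exists (V * W)%g.
by rewrite /vtx_orbit (lact_orbit H (act := lact)) ?fE // => *; rewrite lactM.
Qed.
Definition tr_vtx M' M V (H : cyc_conj M' M V) (f : PSL2Z -> set PSL2Z)
    (fE : forall h W, f (h * W)%g = lact h (f W))
    (v : [set vtx_orbit M' v | v in range f]) :
    [set vtx_orbit M v | v in range f] :=
  SigSub (mem_set (tr_vtx_subproof H fE v)).

Lemma tr_edge_bij M' M V (H : cyc_conj M' M V) : bijective (tr_edge H).
Proof.
exists (tr_edge (cyc_conjV H)) => e; apply: val_inj; first exact: lactK.
exact: lactVK.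
Qed.

Lemma tr_vtx_bij M' M V (H : cyc_conj M' M V) f
    (fE : forall h W, f (h * W)%g = lact h (f W)) : bijective (tr_vtx H fE).
Proof.
exists (tr_vtx (cyc_conjV H) fE) => e; apply: val_inj;
  rewrite /= image_comp -[RHS]image_id; apply: eq_imagel => v _ /=.
- exact: lactK.
- exact: lactVK.
Qed.

Lemma tr_is_iso M' M V (H : cyc_conj M' M V) :
  @is_iso (cark_graph M') (cark_graph M) (tr_edge H)
    (tr_vtx H farey_w_lact) (tr_vtx H farey_b_lact).
Proof.
split=> [|||e|e|e].
- exact: tr_edge_bij.
- exact: tr_vtx_bij.
- exact: tr_vtx_bij.
- apply: val_inj; rewrite /= /lact !image_comp.
  by apply: eq_imagel => W _; exact: farey_w_lact.
- apply: val_inj; rewrite /= /lact !image_comp.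
  by apply: eq_imagel => W _; exact: farey_b_lact.
- apply: val_inj; rewrite /= /lact !image_comp.
  by apply: eq_imagel => W _ /=; rewrite mulgA.
Qed.

Lemma is_iso_id G : @is_iso G G id id id.
Proof. by split=> //; exists id. Qed.

Lemma is_iso_comp G1 G2 G3 fE fw fb gE gw gb :
  @is_iso G1 G2 fE fw fb -> @is_iso G2 G3 gE gw gb ->
  is_iso (gE \o fE) (gw \o fw) (gb \o fb).
Proof.
move=> [bE bw bb few feb fen] [bE' bw' bb' gew geb gen].
split; [exact: bij_comp|exact: bij_comp|exact: bij_comp|..] => e /=.
- by rewrite gew few.
- by rewrite geb feb.
- by rewrite gen fen.
Qed.

Lemma is_iso_inv G1 G2 fE fw fb : @is_iso G1 G2 fE fw fb ->
  exists gE gw gb, cancel fE gE /\ @is_iso G2 G1 gE gw gb.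
Proof.
move=> [[gE fEK gEK] [gw fwK gwK] [gb fbK gbK] few feb fen].
exists gE, gw, gb; split=> //.
split; [by exists fE|by exists fw|by exists fb|..] => e.
- by rewrite -[LHS]fwK -few gEK.
- by rewrite -[LHS]fbK -feb gEK.
- by rewrite -[LHS]fEK -fen gEK.
Qed.

Lemma cark_iso_refl X : cark_iso X X.
Proof. by exists id, id, id; split; [exact: is_iso_id|rewrite image_id|]. Qed.

Lemma cark_iso_sym X Y : cark_iso X Y -> cark_iso Y X.
Proof.
move=> [fE [fw [fb [/is_iso_inv[gE [gw [gb [fK gI]]]] dE bE]]]].
exists gE, gw, gb; split=> //; last by rewrite -bE fK.
rewrite -dE image_comp -[RHS]image_id; apply: eq_imagel => e _; exact: fK.
Qed.

Lemma cark_iso_trans X Y Z : cark_iso X Y -> cark_iso Y Z -> cark_iso X Z.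
Proof.
move=> [fE [fw [fb [fI fd fB]]]] [gE [gw [gb [gI gd gB]]]].
exists (gE \o fE), (gw \o fw), (gb \o fb); split; first exact: is_iso_comp gI.
  by rewrite -image_comp fd.
by rewrite /= fB.
Qed.

Lemma cark_class_eq X Y : cark_iso X Y -> cark_class X = cark_class Y.
Proof.
move=> XY; apply/seteqP; split=> Z [oZ iZ]; split=> //.
  exact: cark_iso_trans (cark_iso_sym XY) iZ.
exact: cark_iso_trans XY iZ.
Qed.

(** If the base edge is the orbit of V, left multiplication by V carries the çark of [M0 ^ V], based
    at the orbit of 1, to the given one; the orientation chooses between [M0 ^ V] and its
    inverse. *)
Lemma oriented_cark_iso X : oriented_cark X ->
  exists2 M, hyperbolic M & cark_iso (cark_of M) X.
Proof.
case: X => M0 O e0 [/= hM0 oO]; have [V ->] := cark_edgeP e0.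
suff [M [hM H OE]] : exists M, [/\ hyperbolic M, cyc_conj M M0 V &
    forall W, O (cark_proj M0 (V * W)%g) <-> pos (M ^ W)%g].
  exists M => //.
  exists (tr_edge H), (tr_vtx H farey_w_lact), (tr_vtx H farey_b_lact).
  split; [exact: tr_is_iso| |by rewrite /= tr_edge_proj mulg1].
  apply/seteqP; split=> e /=.
    move=> [_ [W /(axis_posP _ hM) pW <-] <-]; rewrite tr_edge_proj.
    exact/OE.
  have [W ->] := cark_edgeP e; rewrite -(mulVKg V W) => /OE pW.
  exists (cark_proj M (V^-1 * W)%g); last by rewrite tr_edge_proj.
  exact/(cark_dirP _ hM).
have [OE|OE] := orientation_cases hM0 oO.
  exists (M0 ^ V)%g; split; [exact: hyperbolicJ|exact: cyc_conjJ|].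
  by move=> W; rewrite OE conjgM.
exists (M0 ^ V)^-1%g; split; [exact/hyperbolicV/hyperbolicJ| |].
  by move=> h; rewrite cyc_inv; exact: cyc_conjJ.
by move=> W; rewrite OE conjgM conjVg.
Qed.

(** M equals its own power of exponent kj or -kj, and infinite order forces kj = 1. *)
Lemma cyc_gen M M' : hyperbolic M -> cyc M M' -> cyc M' M ->
  M' = M \/ M' = M^-1%g.
Proof.
move=> hM [k kE] [j jE].
have kj : (M = M ^+ (k * j) \/ M = M ^- (k * j))%g.
  by case: kE => E; move: jE; rewrite E ?expVgn ?invgK -?expgnA; case; auto.
have {kj} kj1 : (k * j)%N = 1%N.
  case: kj => E.
    case: (k * j)%N E => [|[//|n]] E; exfalso.
      by apply: (@hyperbolic_expg_neq1 M 0 hM); rewrite {1}E.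
    apply: (@hyperbolic_expg_neq1 M n hM); apply: (@mulgI _ M).
    by rewrite -expgS -E mulg1.
  exfalso; apply: (@hyperbolic_expg_neq1 M (k * j)%N hM).
  by rewrite expgS {1}E mulVg.
have k1 : k = 1%N by move/eqP: kj1; rewrite muln_eq1 => /andP[/eqP].
by rewrite k1 expg1 in kE.
Qed.

Lemma cark_of_inj M M' : hyperbolic M -> hyperbolic M' ->
  cark_iso (cark_of M) (cark_of M') -> M = M'.
Proof.
move=> hM hM' [fE [fw [fb [[bE bw bb few feb fen] /= dE baseE]]]].
have projR W : fE (cark_proj M W) = cark_proj M' W ->
    fE (cark_proj M (W * genR)%g) = cark_proj M' (W * genR)%g.
  by move=> WE; rewrite -!cark_next_proj -WE; exact/esym/fen.
have projS W : fE (cark_proj M W) = cark_proj M' W ->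
    fE (cark_proj M (W * genS)%g) = cark_proj M' (W * genS)%g.
  (* The image shares its ⊗-end with the edge of W, so it is that edge or the edge of WS;
     injectivity excludes the former. *)
  move=> WE; have [V VE] := cark_edgeP (fE (cark_proj M (W * genS)%g)).
  have : cark_wend (cark_proj M' W) = cark_wend (cark_proj M' V).
    have /esym wS :
        cark_wend (cark_proj M W) = cark_wend (cark_proj M (W * genS)%g).
      by apply/cark_wendP; right.
    rewrite -WE -VE; apply: etrans (few _) _.
    by apply: etrans (esym (few _)); congr fw.
  move/cark_wendP; rewrite -VE; case=> //; rewrite -WE => /(bij_inj bE) /esym.
  by move/(cark_proj_neqS hM).
have projE W : fE (cark_proj M W) = cark_proj M' W.
  elim/psl_ind: W => // W; split; try by [apply: projR|apply: projS].
    by move=> /projR /projR; rewrite -!mulgA genR3 mulg1.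
  by move=> /projS; rewrite -mulgA genSS mulg1.
(* N lies in <M> iff N and 1 have the same image in the çark, a relation that [fE] transports. *)
have memP N : cyc M N <-> cyc M' N.
  split=> h.
    have /(congr1 fE) : cark_proj M (N * 1)%g = cark_proj M 1%g.
      exact: cark_proj_eq.
    rewrite !projE mulg1 => /esym /cark_projP[k Mk ->].
    by rewrite mulg1.
  have : cark_proj M' (N * 1)%g = cark_proj M' 1%g by exact: cark_proj_eq.
  rewrite -!projE mulg1 => /(bij_inj bE) /esym /cark_projP[k Mk ->].
  by rewrite mulg1.
have cycg N : cyc N N by exists 1%N; left; rewrite expg1.
have [//|E] : M' = M \/ M' = M^-1%g.
  by apply: cyc_gen => //; [apply/memP|apply/(memP M)].
exfalso; have [W pW] := hyperbolic_pos hM.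
have : (fE @` cark_dir (cark_of M)) (cark_proj M' W).
  by rewrite -projE; exists (cark_proj M W) => //; apply/(cark_dirP _ hM).
by rewrite dE => /(cark_dirP _ hM'); rewrite E conjVg; exact: pos_asym.
Qed.

(** * Automorphs of forms *)

Lemma gcdz_pmulr (u m n : int) : 0 < u -> gcdz (u * m) (u * n) = u * gcdz m n.
Proof. by move=> u0; rewrite -mulz_gcdr gez0_abs // ltW. Qed.

(** Primitivity makes u the gcd by which [bqf_of] divides. *)
Lemma psl_bqf_of (A B C p q r s u : int) :
  p * s - q * r = 1 -> 2 < p + s -> 0 < u ->
  r = u * A -> s - p = u * B -> - q = u * C ->
  gcdz (gcdz A B) C = 1 -> bqf_of (psl p q r s) = BQF A B C.
Proof.
move=> e t2 u0 rE spE qE prim; rewrite bqf_of_psl //=.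
have -> : gcdz q (gcdz (s - p) r) = u.
  rewrite -[q]opprK qE rE spE gcdNz !gcdz_pmulr //.
  by rewrite [gcdz B A]gcdzC gcdzC prim mulr1.
rewrite gtr0_sgz ?mul1r; last by lia.
have u1 : u != 0 by rewrite gt_eqF.
by rewrite qE rE spE ![u * _]mulrC !mulzK.
Qed.

(** The discriminant of the form is (p + s)^2 - 4 divided by g^2, hence positive and not a
    square. *)
Lemma bqf_of_hyperbolic M : hyperbolic M ->
  [/\ primitive (bqf_of M), indefinite (bqf_of M) & ~ square_disc (bqf_of M)].
Proof.
move=> /hyperbolicP[p [q [r [s [e t2 ->]]]]].
pose g := gcdz q (gcdz (s - p) r).
have g0 : 0 < g.
  rewrite lt_def; apply/andP; split; last by [].
  by rewrite !gcdz_eq0; apply/negP => /and3P[/eqP q0 /eqP sp /eqP r0]; nia.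
have /dvdzP[q' qE] : (g %| q)%Z by rewrite dvdz_gcdl.
have /dvdzP[b' bE] : (g %| s - p)%Z.
  by rewrite (dvdz_trans (dvdz_gcdr _ _)) ?dvdz_gcdl.
have /dvdzP[r' rE] : (g %| r)%Z.
  by rewrite (dvdz_trans (dvdz_gcdr _ _)) ?dvdz_gcdr.
have prim : gcdz (gcdz r' b') (- q') = 1.
  apply: (@mulfI _ g); first by rewrite gt_eqF.
  rewrite mulr1 -!gcdz_pmulr //.
  by rewrite mulrN gcdzN ![g * _]mulrC -qE -bE -rE gcdzC [gcdz r _]gcdzC.
rewrite (psl_bqf_of e t2 g0 (A := r') (B := b') (C := - q')) //; first last.
- by rewrite mulrN {1}qE mulrC.
- by rewrite {1}bE mulrC.
- by rewrite {1}rE mulrC.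
have D : g ^+ 2 * disc (BQF r' b' (- q')) = (p + s) ^+ 2 - 4.
  transitivity ((s - p) ^+ 2 + 4 * r * q).
    by rewrite bE rE qE /disc /=; ring.
  rewrite !expr2; lia.
split=> //.
  by rewrite /indefinite -(pmulr_rgt0 _ (exprn_gt0 2 g0)) D; nia.
by move=> [k kE]; apply: (@sqr_trace_subr4 _ (g * k) t2); rewrite -D kE exprMn.
Qed.

(** * The cycle of reduced forms *)

Definition reduced (f : bqf) : Prop := 0 < qA f /\ qC f < 0.

(** The tested sum is f(1, 1), which becomes the first coefficient under L and the last one under U;
    its sign tells which of the two keeps A > 0 > C. *)
Definition step (f : bqf) : bqf :=
  if 0 < qA f + qB f + qC f then bqf_act f 1 0 1 1 else bqf_act f 1 1 0 1.

(** If f(1, 1) = 0, then B = -(A + C) and the discriminant is (A - C)^2. *)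
Lemma reduced_step f : reduced f -> ~ square_disc f -> reduced (step f).
Proof.
move=> [A0 C0] fs; rewrite /step.
case: ifP => [S0|/negbT S0]; split=> /=; try lia.
move: S0; rewrite -leNgt le_eqVlt => /orP[/eqP S0|]; last by lia.
case: fs; exists (qA f - qC f); rewrite /disc.
have -> : qB f = - (qA f + qC f) by lia.
by rewrite !expr2; lia.
Qed.

(** The bound on the sum of the entries will show that a period gives a non-trivial automorph. *)
Lemma iter_step_act n f : exists a b c d,
  [/\ [/\ 0 <= a, 0 <= b, 0 <= c & 0 <= d], a * d - b * c = 1,
      n%:Z + 2 <= a + b + c + d & iter n step f = bqf_act f a b c d].
Proof.
elim: n => [|n [a [b [c [d [[a0 b0 c0 d0] e le_n E]]]]]] /=.
  by exists 1, 0, 0, 1; rewrite bqf_act1.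
have h : 0 < a /\ 0 < d by nia.
rewrite E {1}/step !bqf_actM; case: ifP => _.
  exists (a * 1 + b * 1), (a * 0 + b * 1), (c * 1 + d * 1), (c * 0 + d * 1).
  by split=> //; [split; lia|lia|lia].
exists (a * 1 + b * 0), (a * 1 + b * 1), (c * 1 + d * 0), (c * 1 + d * 1).
by split=> //; [split; lia|lia|lia].
Qed.

Lemma iter_step_reduced n f : reduced f -> ~ square_disc f ->
  reduced (iter n step f) /\ disc (iter n step f) = disc f.
Proof.
move=> fr fs; elim: n => [//|n [IH D]] /=; split.
  by apply: reduced_step => // -[k]; rewrite D => kE; apply: fs; exists k.
by rewrite -D /step; case: ifP => _; apply: disc_act; lia.
Qed.

(** For A > 0 > C the discriminant B^2 + 4A|C| bounds all three coefficients, so the iterates repeat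
    by the pigeonhole principle. *)
Lemma iter_step_period f : reduced f -> ~ square_disc f ->
  exists i k, iter k.+1 step (iter i step f) = iter i step f.
Proof.
move=> fr fs; pose D := absz (disc f).
have bound n : let g := iter n step f in
    [/\ (absz (qA g) <= D)%N, (absz (qC g) <= D)%N & `|qB g| <= D%:Z].
  have [[A0 C0] gD] := iter_step_reduced n fr fs.
  rewrite /= /D -gD /disc; set g := iter n step f in A0 C0 *.
  have := sqr_ge0 (qB g); have AC := mulr_gt0 A0 (_ : 0 < - qC g).
  have hA : qA g <= qA g * - qC g by nia.
  have hC : - qC g <= qA g * - qC g by nia.
  have hB : `|qB g| <= qB g ^+ 2 by rewrite expr2; nia.
  by move=> hB2; split; lia.
(* [qB g + D] takes values from 0 to 2D; the signs of A and C are known, so absolute values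
   determine them. *)
pose N := (D * 2).+1.
pose code (n : 'I_(N * N * N).+1) : 'I_N * 'I_N * 'I_N :=
  let g := iter n step f in
  (inord (absz (qA g)), inord (absz (qC g)), inord (absz (qB g + D%:Z))).
have /injectivePn[i [j ij]] : ~~ injectiveb code.
  apply/negP => /injectiveP /leq_card.
  by rewrite !card_prod !card_ord ltnn.
wlog ltij : i j ij / (i < j)%N.
  move=> W E; have [lt|lt|eq] := ltngtP i j.
  - exact: (W i j).
  - by apply: (W j i); rewrite // eq_sym.
  - by rewrite (val_inj eq) eqxx in ij.
move=> E; exists i, (j - i).-1.
have -> : (j - i).-1.+1 = (j - i)%N by lia.
rewrite -iterD subnK; last exact: ltnW.
have [Ai Ci Bi] := bound i; have [Aj Cj Bj] := bound j.
have [[A0 C0] Di] := iter_step_reduced i fr fs.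
have [[A0' C0'] Dj] := iter_step_reduced j fr fs.
move: Ai Ci Bi Aj Cj Bj A0 C0 A0' C0' Di Dj E; rewrite /code.
move: (iter i step f) (iter j step f).
move=> [A B C] [A' B' C'] /= Ai Ci Bi Aj Cj Bj A0 C0 A0' C0' Di Dj.
move=> [/(congr1 (@nat_of_ord _)) + /(congr1 (@nat_of_ord _)) +
  /(congr1 (@nat_of_ord _))].
rewrite !inordK /N; try by lia.
by move=> hB hC hA; congr BQF; lia.
Qed.

Definition bqf_automorph (f : bqf) (p q r s : int) : Prop :=
  p * s - q * r = 1 /\ bqf_act f p q r s = f.

(** If V takes f to a form on its reduction cycle and P is the product of the steps of a period,
    then V P V^-1 is an automorph of f. *)
Lemma bqf_automorph_exists f : indefinite f -> ~ square_disc f ->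
  exists p q r s, bqf_automorph f p q r s /\ psl p q r s <> 1%g.
Proof.
move=> f0 fs; have [a0 [b0 [c0 [d0 [e0 A0 C0]]]]] := bqf_reduction f0 fs.
set f1 := bqf_act f a0 b0 c0 d0 in A0 C0.
have f1s : ~ square_disc f1.
  by move=> [k kE]; apply: fs; exists k; rewrite -kE disc_act.
have [i [k]] := iter_step_period (conj A0 C0) f1s.
have [a [b [c [d [e ->]]]]] : exists a b c d,
    a * d - b * c = 1 /\ iter i step f1 = bqf_act f a b c d.
  have [a1 [b1 [c1 [d1 [_ e1 _ ->]]]]] := iter_step_act i f1.
  rewrite /f1 bqf_actM; do 4!eexists; split; last by [].
  by rewrite -[RHS](mulr1 1) -{1}e0 -e1; ring.
have [p [q [r [s [_ eP le_k ->]]]]] := iter_step_act k.+1 (bqf_act f a b c d).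
move=> PE; have e' : d * a - (- b) * (- c) = 1 by rewrite -e; ring.
have := pslJ eP e'.
set p' := _ - _; set q' := _ - _; set r' := _ - _; set s' := _ - _ => JE.
exists p', q', r', s'; split; last first.
  (* P has nonnegative entries of sum at least 3, so it is not the identity up to sign. *)
  rewrite -JE => /eqP; rewrite conjg_eq1 -psl1 => /eqP /psl_eqE [] // []; lia.
split.
  transitivity ((p * s - q * r) * (a * d - b * c) ^+ 2).
    by rewrite /p' /q' /r' /s'; ring.
  by rewrite eP e expr1n.
have VK : bqf_act (bqf_act f a b c d) d (- b) (- c) a = f.
  rewrite bqf_actM -[RHS]bqf_act1; congr bqf_act; rewrite -?e; ring.
rewrite -[RHS]VK -PE !bqf_actM /p' /q' /r' /s'; congr bqf_act; ring.
Qed.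

(** Let P be the automorph and F the Gram matrix with rows (2A, B) and (B, 2C). The entries of P^T F
    = F P^-1 say that (r, s - p, -q) is proportional to (A, B, C), and primitivity makes the factor
    an integer. *)
Lemma bqf_automorph_span f p q r s : primitive f -> bqf_automorph f p q r s ->
  exists u, [/\ r = u * qA f, s - p = u * qB f & - q = u * qC f].
Proof.
case: f => A B C; rewrite /primitive /= => prim [e []] hA hB hC.
have [x0 [y0 xyE]] := Bezoutz A B; have [w [z wzE]] := Bezoutz (gcdz A B) C.
have bez : w * x0 * A + w * y0 * B + z * C = 1.
  by rewrite -prim -wzE -xyE; ring.
move: (w * x0) (w * y0) bez => x y bez.
have AB : A * (s - p) = B * r.
  have : 2 * s * (A * p * p + B * p * r + C * r * r) -
      r * (2 * A * p * q + B * (p * s + q * r) + 2 * C * r * s) =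
      (2 * A * p + B * r) * (p * s - q * r) by ring.
  by rewrite hA hB e; lia.
have AC : A * - q = C * r.
  have : s * (2 * A * p * q + B * (p * s + q * r) + 2 * C * r * s) -
      2 * r * (A * q * q + B * q * s + C * s * s) =
      (2 * A * q + B * s) * (p * s - q * r) by ring.
  by rewrite hB hC e; lia.
have BC : B * - q = C * (s - p).
  have : 2 * p * (A * q * q + B * q * s + C * s * s) -
      q * (2 * A * p * q + B * (p * s + q * r) + 2 * C * r * s) =
      (B * q + 2 * C * s) * (p * s - q * r) by ring.
  by rewrite hB hC e; lia.
(* The factor is obtained by pairing with the Bezout coefficients of (A, B, C). *)
exists (x * r + y * (s - p) + z * - q); split.
- rewrite -[LHS]mulr1 -bez.
  transitivity (x * r * A + y * (B * r) + z * (C * r)); first by ring.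
  by rewrite -AB -AC; ring.
- rewrite -[LHS]mulr1 -bez.
  transitivity (x * (A * (s - p)) + y * (s - p) * B + z * (C * (s - p))).
    by ring.
  by rewrite AB -BC; ring.
- rewrite -[LHS]mulr1 -bez.
  transitivity (x * (A * - q) + y * (B * - q) + z * - q * C); first by ring.
  by rewrite AC BC; ring.
Qed.

(** For a non-trivial automorph the factor u is nonzero, so (p + s)^2 - 4 = u^2 disc f > 0 and the
    automorph is hyperbolic. *)
Lemma bqf_of_surj f : primitive f -> indefinite f -> ~ square_disc f ->
  exists2 M, hyperbolic M & bqf_of M = f.
Proof.
move=> prim f0 fs.
have [p [q [r [s [aut neq1]]]]] := bqf_automorph_exists f0 fs.
have [u [rE spE qE]] := bqf_automorph_span prim aut.
have {aut} [e _] := aut.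
case: f prim f0 fs rE spE qE => A B C /= prim f0 _ rE spE qE.
have u0 : u != 0.
  apply/eqP => u0; rewrite u0 !mul0r in rE spE qE; apply: neq1.
  have [-> -> -> sE] : [/\ p = s, q = 0, r = 0 & s * s = 1].
    have sp : p = s by lia.
    by rewrite rE sp mulr0 subr0 in e; split=> //; lia.
  have [->|->] : s = 1 \/ s = -1 by nia.
    exact: psl1.
  by rewrite -psl1 -[RHS]pslN.
have t4 : (p + s) ^+ 2 - 4 = u ^+ 2 * disc (BQF A B C).
  transitivity ((s - p) ^+ 2 - 4 * r * (- q)); first by rewrite !expr2; lia.
  by rewrite rE spE qE /disc /=; ring.
have t2 : 4 < (p + s) ^+ 2.
  by rewrite -subr_gt0 t4; apply: mulr_gt0 => //; rewrite exprn_even_gt0.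
(* Negating the matrix makes its trace positive. *)
wlog t0 : p q r s u neq1 e rE spE qE u0 t4 t2 / 0 < p + s.
  move=> W; have [t0|t0] := ltrP 0 (p + s); first exact: (W p q r s u).
  apply: (W (- p) (- q) (- r) (- s) (- u));
    rewrite ?pslN ?oppr_eq0 ?sqrrN //; try lia.
  by nia.
have {}t2 : 2 < p + s by nia.
have main p' q' r' s' u' : p' * s' - q' * r' = 1 -> 2 < p' + s' -> 0 < u' ->
   r' = u' * A -> s' - p' = u' * B -> - q' = u' * C ->
   exists2 M, hyperbolic M & bqf_of M = BQF A B C.
  move=> e' t' u'0 rE' spE' qE'.
  exists (psl p' q' r' s'); last exact: psl_bqf_of qE' prim.
  by rewrite /hyperbolic /= abs_tr_psl // gtr0_norm //; lia.
have [u1|u1] := ltrP 0 u; first exact: (main p q r s u).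
(* The inverse has the same trace and the opposite u. *)
by apply: (main s (- q) (- r) p (- u)); lia.
Qed.

(** [theta] is the arrow from çarks to matrices: the first two clauses make it the two-sided inverse
    of [cark_of] on classes, so the composite in question is [bqf_of] after [theta]. *)
Theorem corollary4p1 :
  exists theta : set based_cark -> PSL2Z,
    [/\ (forall M : PSL2Z, hyperbolic M ->
           cark_classes (cark_class (cark_of M)) /\
           theta (cark_class (cark_of M)) = M),
        (forall c : set based_cark, cark_classes c ->
           hyperbolic (theta c) /\ cark_class (cark_of (theta c)) = c),
        (forall c : set based_cark, cark_classes c ->
           [/\ primitive (bqf_of (theta c)), indefinite (bqf_of (theta c)) &
               ~ square_disc (bqf_of (theta c))]) &
        (forall f : bqf, primitive f -> indefinite f -> ~ square_disc f ->
           exists2 c : set based_cark, cark_classes c & bqf_of (theta c) = f)].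
Proof.
(* The default [psl_one] is taken only outside [cark_classes]. *)
pose theta (c : set based_cark) :=
  xget psl_one [set M | hyperbolic M /\ cark_class (cark_of M) = c].
have thetaP c : cark_classes c ->
    hyperbolic (theta c) /\ cark_class (cark_of (theta c)) = c.
  move=> [X oX <-]; have [M hM iM] := oriented_cark_iso oX.
  apply: (@xgetPex _ psl_one
    [set M | hyperbolic M /\ cark_class (cark_of M) = cark_class X]).
  by exists M; split=> //; exact: cark_class_eq.
have classM M : hyperbolic M -> cark_classes (cark_class (cark_of M)).
  by move=> hM; exists (cark_of M) => //; exact: oriented_cark_of.
have thetaK M : hyperbolic M -> theta (cark_class (cark_of M)) = M.
  move=> hM; have [hT clT] := thetaP _ (classM M hM).
  apply/esym/cark_of_inj => //.
  have : cark_class (cark_of M) (cark_of (theta (cark_class (cark_of M)))).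
    by rewrite -{1}clT; split; [exact: oriented_cark_of|exact: cark_iso_refl].
  by case.
exists theta; split=> [M hM|c cc|c cc|f prim f0 fs].
- by split; [exact: classM|exact: thetaK].
- exact: thetaP.
- by apply: bqf_of_hyperbolic; have [] := thetaP c cc.
- have [M hM ME] := bqf_of_surj prim f0 fs.
  by exists (cark_class (cark_of M)); [exact: classM|rewrite thetaK].
Qed.
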